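(* For every integer $n\geq 5$, the closure number of the alternating group $A_n$ satisfies $k(A_n)=n-1$.
   Context: For a group $G$ acting on a set $\Omega$ and a positive integer $k$, the $k$-closure $G^{(k),\Omega}$ is the set of all permutations $g\in\mathrm{Sym}(\Omega)$ that leave invariant each $G$-orbit in the induced $G$-action on the set $\Omega^k$ of ordered $k$-tuples of points of $\Omega$; it is a subgroup of $\mathrm{Sym}(\Omega)$ containing the permutation group induced by $G$ on $\Omega$. A group $G$ is totally $k$-closed if $G=G^{(k),\Omega}$ for each set $\Omega$ upon which $G$ acts faithfully (where $G$ is identified with the permutation group it induces on $\Omega$). For a finite group $G$, the closure number $k(G)$ is the least positive integer $k$ such that $G$ is totally $k$-closed. *)

(* Defs.v *)
From HB Require Import structures.
From mathcomp Require Import all_boot all_fingroup all_solvable.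
From mathcomp Require Import boolp classical_sets.

Set Implicit Arguments.
Unset Strict Implicit.
Unset Printing Implicit Defensive.

Local Open Scope classical_set_scope.

(* [Omega] is an arbitrary, possibly infinite, type. The notions of [action.v]
   for orbits and faithfulness need a finite type, so they are restated. *)

Definition faithful_action (gT : finGroupType) (G : {group gT})
    (Omega : Type) (to : action G Omega) : Prop :=
  forall a, a \in G -> (forall x, to x a = x) -> a = 1%g.

Definition tuple_orbit (k : nat) (gT : finGroupType) (G : {group gT})
    (Omega : Type) (to : action G Omega) (t : k.-tuple Omega) :
    set (k.-tuple Omega) :=
  [set map_tuple (to^~ a) t | a in [set a | a \in G]].

Definition induced_permutations (gT : finGroupType) (G : {group gT})
    (Omega : Type) (to : action G Omega) : set (Omega -> Omega) :=
  [set to^~ a | a in [set a | a \in G]].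

Definition k_closure (k : nat) (gT : finGroupType) (G : {group gT})
    (Omega : Type) (to : action G Omega) : set (Omega -> Omega) :=
  [set g | bijective g /\
     forall t : k.-tuple Omega,
       map_tuple g @` tuple_orbit to t = tuple_orbit to t].

Definition totally_closed (k : nat) (gT : finGroupType) (G : {group gT}) :
    Prop :=
  forall (Omega : Type) (to : action G Omega),
    faithful_action to -> k_closure k to = induced_permutations to.

(* The default value 0 is not positive, so [closure_number G = k] with [0 < k]
   implies that the least element exists. *)
Definition closure_number (gT : finGroupType) (G : {group gT}) : nat :=
  xget 0 [set k | [/\ 0 < k, totally_closed k G &
    forall j, 0 < j -> totally_closed j G -> k <= j]].

(* Main.v *)
Require Import Defs.
From mathcomp Require Import all_boot all_fingroup all_solvable.
From mathcomp Require boolp classical_sets.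

(** The lower bound comes from the natural action on [n] points. If [j <= n - 2]
    then any [j]-tuple misses two points [x] and [y], so an odd permutation [h]
    acts on the tuple as the even permutation [(x y) h] does. All of [Sym(n)]
    thus preserves the orbits of [Alt(n)] on [j]-tuples.

    For the upper bound, a permutation that preserves the orbits on
    [(m + 1)]-tuples agrees with one group element everywhere as soon as the
    action has a base of [m] points ([k_closure_of_base]). So every faithful
    action of [Alt(n)] must be given a base of [n - 2] points. Such a base can
    be found in the orbit of any point that is moved: if [L] is the stabiliser
    of this point, then [n - 2] conjugates of the proper subgroup [L] by even
    permutations have to meet trivially ([proper_subgroup_base]).

    Suppose first that [L] preserves an equivalence relation with several
    classes, one of which has at least three points. Explicit three-cycles
    through one point of that class and one point outside it do the job
    ([class_shift_trivial]). This covers the groups [L] with a fixed point. It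
    also covers those that contain a three-cycle: call two points related if
    they are equal or some three-cycle in [L] moves both.

    Otherwise [L] contains no three-cycle and fixes no point. Conjugate [L] by
    one transposition to get [M], and consider the star of the [n - 2]
    conjugates [M ^ (p j)], where [j] runs over all points but [p] and [r]. They
    are conjugates of [L] by even permutations. If [k] lies in all of them, then
    [(p j) (k p, k j)] lies in the coset [M k] for every [j]. Quotients of two
    such elements lie in [M] and move few points, and unless [k] is very special
    a short word in them is a three-cycle. The outcome is that [k] lies in [M]
    ([full_star_mem]), and that [k = 1] or [k] is an involution which moves
    every point except possibly [r], while [M] contains the products
    [(x y) (k x, k y)] for all moved points [x] and [y] from different orbits
    ([full_star_involution]).

    In the second situation, if [k] fixes [r] then so does [M], which is
    excluded. If [k] has no fixed point, the star may really fail: the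
    stabiliser of a partition into pairs has this form when [4] divides [n], and
    so does [AGL(3,2)] in degree [8]. But now a set [B] of representatives of
    the orbits of [k] can be chosen such that [M] contains no [(a b) (c d)] with
    entries in [B]. The star with centre [p] and leaves in [B] intersects in a
    group [K] in which only the identity fixes [p]
    ([transversal_star_centre_inj]). So [K] has order at most [n < 2 ^ (n / 2)].
    As [Alt(n)] is simple, some conjugate of [L] does not contain [K], and
    intersecting with it at least halves the order. Hence [n / 2 - 1] leaves and
    [n / 2 - 1] further conjugates suffice. *)

Set Implicit Arguments.
Unset Strict Implicit.
Unset Printing Implicit Defensive.

Import GroupScope.

(** * Distinct points *)

Lemma eq_perm_mem (T : finType) (M : {set {perm T}}) (g h : {perm T}) :
  g = h -> g \in M -> h \in M.
Proof. by move=> ->. Qed.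

Lemma exists_in_notin (T : finType) (B : {set T}) (s : seq T) :
  size s < #|B| -> exists2 x, x \in B & x \notin s.
Proof.
move=> lt; have: ~~ (B \subset s).
  by apply: contraL lt => /subset_leq_card; rewrite -leqNgt =>
    /leq_trans/(_ (card_size s)).
by case/subsetPn=> x; exists x.
Qed.

Lemma exists_notin (T : finType) (s : seq T) :
  size s < #|T| -> exists x, x \notin s.
Proof.
by rewrite -cardsT => /exists_in_notin[x _ xs]; exists x.
Qed.

Lemma double_lt_exp2 m : 2 < m -> m.*2 < 2 ^ m.
Proof.
elim: m => // m IHm; rewrite ltnS leq_eqVlt => /predU1P[<- // | m2].
have lt := IHm m2.
rewrite doubleS expnS mul2n -(addnn (2 ^ m)) -addn2 leq_add //.
by apply: leq_trans lt; rewrite ltnS double_gt0; apply: leq_trans m2.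
Qed.

Lemma perm_neq (T : finType) (k : {perm T}) (x y x' y' : T) :
  k x = x' -> k y = y' -> (x' != y') = (x != y).
Proof. by move=> <- <-; rewrite (inj_eq perm_inj). Qed.

(** Distinctness of points of which some are images of others under a
    permutation: equations [k x = a] and [k y = b] in the context allow passing
    between [a != b] and [x != y]. *)
Ltac neq n :=
  first
  [ assumption
  | rewrite eq_sym; assumption
  | lazymatch n with S ?m =>
      match goal with
      | Hx : fun_of_perm ?k ?x = ?a, Hy : fun_of_perm ?k ?y = ?b
          |- is_true (?a != ?b) => rewrite (perm_neq Hx Hy); neq m
      | Hx : fun_of_perm ?k ?x = ?a, Hy : fun_of_perm ?k ?y = ?b
          |- is_true (?x != ?y) => rewrite -(perm_neq Hx Hy); neq m
      end
    end ].

Ltac all_neq :=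
  rewrite /= ?inE ?negb_or ?andbT;
  repeat match goal with |- is_true (_ && _) => apply/andP; split end;
  neq 4.

Ltac tperm_eval :=
  repeat match goal with
  | |- context [fun_of_perm (tperm ?a ?b) ?a] => rewrite (tpermL a b)
  | |- context [fun_of_perm (tperm ?a ?b) ?b] => rewrite (tpermR a b)
  | |- context [fun_of_perm (tperm ?a ?b) ?x] =>
      is_var x; rewrite (@tpermD _ a b x); [ | neq 4 | neq 4 ]
  end.

(** * Words in transpositions of named points *)

(** The arguments below multiply transpositions of a handful of points and
    compare the results. Once the points are distinct such a comparison depends
    on their positions in a list only, and is decided by computing with these
    indices. *)
Inductive tword : Type :=
| TSwap of nat & nat
| TMul of tword & tword
| TInv of tword
| TConj of tword & tword.

Fixpoint tword_perm (T : finType) (x0 : T) (s : seq T) (w : tword) :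
    {perm T} :=
  match w with
  | TSwap i j => tperm (nth x0 s i) (nth x0 s j)
  | TMul v w => tword_perm x0 s v * tword_perm x0 s w
  | TInv w => (tword_perm x0 s w)^-1
  | TConj v w => tword_perm x0 s v ^ tword_perm x0 s w
  end.

Fixpoint tword_swaps (w : tword) : seq (nat * nat) :=
  match w with
  | TSwap i j => [:: (i, j)]
  | TMul v w => tword_swaps v ++ tword_swaps w
  | TInv w => rev (tword_swaps w)
  | TConj v w => rev (tword_swaps w) ++ tword_swaps v ++ tword_swaps w
  end.

Definition swap_nat (ij : nat * nat) (k : nat) : nat :=
  if k == ij.1 then ij.2 else if k == ij.2 then ij.1 else k.

Definition swaps_nat (l : seq (nat * nat)) (k : nat) : nat :=
  foldl (fun k ij => swap_nat ij k) k l.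

Definition swaps_in (n : nat) (l : seq (nat * nat)) : bool :=
  all (fun ij => (ij.1 < n) && (ij.2 < n)) l.

Definition swaps_eq (n : nat) (l l' : seq (nat * nat)) : bool :=
  [&& swaps_in n l, swaps_in n l' &
      all (fun k => swaps_nat l k == swaps_nat l' k) (iota 0 n)].

Definition swaps_perm (T : finType) (x0 : T) (s : seq T)
    (l : seq (nat * nat)) : {perm T} :=
  \prod_(ij <- l) tperm (nth x0 s ij.1) (nth x0 s ij.2).

Lemma tword_permE (T : finType) (x0 : T) (s : seq T) (w : tword) :
  tword_perm x0 s w = swaps_perm x0 s (tword_swaps w).
Proof.
have revE l : swaps_perm x0 s (rev l) = (swaps_perm x0 s l)^-1.
  rewrite /swaps_perm; elim: l => [|ij l IHl]; first by rewrite !big_nil invg1.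
  by rewrite rev_cons -cats1 big_cat big_seq1 IHl big_cons invMg tpermV.
have catE l l' :
    swaps_perm x0 s (l ++ l') = swaps_perm x0 s l * swaps_perm x0 s l'.
  exact: big_cat.
elim: w => [i j|v IHv w IHw|w IHw|v IHv w IHw] /=.
- by rewrite /swaps_perm big_seq1.
- by rewrite IHv IHw catE.
- by rewrite IHw revE.
by rewrite IHv IHw !catE revE conjgE.
Qed.

(** On the points of the list a word acts as it does on their indices. The bound
    on the index is part of the statement to make the induction go through. *)
Lemma swaps_perm_nth (T : finType) (x0 : T) (s : seq T) l k :
    uniq s -> swaps_in (size s) l -> k < size s ->
  swaps_perm x0 s l (nth x0 s k) = nth x0 s (swaps_nat l k)
  /\ swaps_nat l k < size s.
Proof.
move=> Us; elim: l k => [|[i j] l IHl] k /=.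
  by rewrite /swaps_perm big_nil perm1.
case/andP=> /andP[lti ltj] lin ltk.
have [lt' tE] : swap_nat (i, j) k < size s /\
    tperm (nth x0 s i) (nth x0 s j) (nth x0 s k) = nth x0 s (swap_nat (i, j) k).
  rewrite /swap_nat /= permE /= !(nth_uniq x0) //.
  by case: eqP => // _; case: eqP.
have [IH1 IH2] := IHl _ lin lt'.
by rewrite /swaps_perm big_cons permM tE IH1.
Qed.

Lemma swaps_perm_out (T : finType) (x0 : T) (s : seq T) l x :
    swaps_in (size s) l -> x \notin s -> swaps_perm x0 s l x = x.
Proof.
move=> lin xs; elim: l lin => [|[i j] l IHl] /=.
  by rewrite /swaps_perm big_nil perm1.
case/andP=> /andP[lti ltj] lin.
rewrite /swaps_perm big_cons permM tpermD ?IHl //=.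
  by apply: contraNneq xs => <-; rewrite mem_nth.
by apply: contraNneq xs => <-; rewrite mem_nth.
Qed.

Lemma swaps_perm_eq (T : finType) (x0 : T) (s : seq T) l l' :
  uniq s -> swaps_eq (size s) l l' -> swaps_perm x0 s l = swaps_perm x0 s l'.
Proof.
move=> Us /and3P[lin l'in /allP eql]; apply/permP=> x.
have [xs | xs] := boolP (x \in s); last by rewrite !swaps_perm_out.
have lt : index x s < size s by rewrite index_mem.
rewrite -(nth_index x0 xs).
have [-> _] := swaps_perm_nth x0 Us lin lt.
have [-> _] := swaps_perm_nth x0 Us l'in lt.
by rewrite (eqP (eql _ _)) // mem_iota.
Qed.

Lemma tword_eq (T : finType) (x0 : T) (s : seq T) (v w : tword) :
    uniq s -> swaps_eq (size s) (tword_swaps v) (tword_swaps w) ->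
  tword_perm x0 s v = tword_perm x0 s w.
Proof. by move=> Us vw; rewrite !tword_permE; apply: swaps_perm_eq. Qed.

Definition three_cycle_free (T : finType) (M : {set {perm T}}) : Prop :=
  forall a b c, uniq [:: a; b; c] -> tperm a b * tperm a c \notin M.

Definition swaps_is_three_cycle (n : nat) (l : seq (nat * nat)) : bool :=
  has (fun a => has (fun b => has (fun c =>
    uniq [:: a; b; c] && swaps_eq n l [:: (a, b); (a, c)])
    (iota 0 n)) (iota 0 n)) (iota 0 n).

(** The way in which all contradictions in a group without three-cycles
    arise. *)
Lemma three_cycle_word (T : finType) (x0 : T) (s : seq T) (w : tword)
    (M : {set {perm T}}) :
    three_cycle_free M -> uniq s -> tword_perm x0 s w \in M ->
  swaps_is_three_cycle (size s) (tword_swaps w) -> False.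
Proof.
move=> M3 Us wM /hasP[a]; rewrite mem_iota /= => lta.
case/hasP=> b; rewrite mem_iota /= => ltb.
case/hasP=> c; rewrite mem_iota /= => ltc.
case/andP=> Uabc wE.
have wE' : tword_perm x0 s w =
    tperm (nth x0 s a) (nth x0 s b) * tperm (nth x0 s a) (nth x0 s c).
  rewrite tword_permE (swaps_perm_eq _ Us wE) /swaps_perm.
  by rewrite big_cons big_seq1.
move: Uabc wM; rewrite wE' /= !inE !andbT negb_or.
case/andP=> /andP[ab ac] bc; apply/negP/M3.
by rewrite /= !inE !nth_uniq // negb_or ab ac bc.
Qed.

Ltac tword_index x s :=
  lazymatch s with
  | x :: _ => constr:(0)
  | _ :: ?s' => let n := tword_index x s' in constr:(S n)
  end.

Ltac tword_of s g :=
  lazymatch g with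
  | tperm ?a ?b =>
      let i := tword_index a s in let j := tword_index b s in
      constr:(TSwap i j)
  | mulg ?g ?h =>
      let v := tword_of s g in let w := tword_of s h in constr:(TMul v w)
  | invg ?g => let v := tword_of s g in constr:(TInv v)
  | conjg ?g ?h =>
      let v := tword_of s g in let w := tword_of s h in constr:(TConj v w)
  end.

Ltac tword_calc Us :=
  lazymatch type of Us with
  | is_true (uniq ?s) =>
    lazymatch s with ?x0 :: _ =>
      lazymatch goal with
      | |- ?g = ?h =>
        let v := tword_of s g in let w := tword_of s h in
        exact (@tword_eq _ x0 s v w Us isT)
      end
    end
  end.

Ltac three_cycle M3 Us gM :=
  lazymatch type of Us with
  | is_true (uniq ?s) =>
    lazymatch s with ?x0 :: _ =>
      lazymatch type of gM with
      | is_true (?g \in _) =>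
        let w := tword_of s g in
        case: (@three_cycle_word _ x0 s w _ M3 Us gM isT)
      end
    end
  end.

(** * The star of conjugates *)

Section Star.

Variables (T : finType) (M : {group {perm T}}).
Hypothesis M3 : three_cycle_free M.

Definition star_group (p : T) (J : {set T}) : {group {perm T}} :=
  (\bigcap_(j in J) (M :^ tperm p j))%G.

Variables (p : T) (J : {set T}) (k : {perm T}).
Hypotheses (pJ : p \notin J) (kS : k \in star_group p J).

Lemma leaf_neq j : j \in J -> j != p.
Proof. by apply: contraTneq => ->. Qed.

Lemma star_conj j : j \in J -> k ^ tperm p j \in M.
Proof.
move=> jJ; move/bigcapP/(_ _ jJ): kS.
by rewrite mem_conjg tpermV.
Qed.

(** With [u_j] for the product [(p j) (k p, k j)], membership of [k] in all
    [M ^ (p j)] puts every [u_j] in the single coset [M k]. This is the source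
    of the small elements of [M]. *)
Lemma star_word p' j j' :
  k p = p' -> k j = j' -> j \in J -> tperm p j * tperm p' j' * k^-1 \in M.
Proof.
move=> kp kj jJ; have:= groupVr (star_conj jJ).
rewrite -kp -kj -tpermJ -conjVg !conjgE tpermV !mulgA.
by rewrite mulgK.
Qed.

Lemma star_quotient p' i i' j j' :
    k p = p' -> k i = i' -> k j = j' -> i \in J -> j \in J ->
  tperm p i * tperm p' i' * (tperm p' j' * tperm p j) \in M.
Proof.
move=> kp ki kj iJ jJ.
have := groupM (star_word kp ki iJ) (groupVr (star_word kp kj jJ)).
by rewrite !invMg !tpermV invgK !mulgA mulgKV.
Qed.

Lemma star_fixed_leaf j : k p = p -> k j = j -> j \in J -> k \in M.
Proof.
by move=> kp kj jJ; have:= star_word kp kj jJ; rewrite tperm2 mul1g groupV.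
Qed.

Lemma star_swapped_leaves i j :
  k p = p -> k i = j -> k j = i -> i != j -> i \in J -> j \in J -> False.
Proof.
move=> kp ki kj ij iJ jJ; have pi := leaf_neq iJ; have pj := leaf_neq jJ.
have U : uniq [:: p; i; j] by all_neq.
have gM := star_quotient kp ki kj iJ jJ.
three_cycle M3 U gM.
Qed.

(** Here [u_j] itself lies in [M], and it is the three-cycle [(p j j')] unless
    [j] is fixed. *)
Lemma star_fixed_leaves_mem j j' :
  k \in M -> k p = p -> k j = j' -> j \in J -> j' = j.
Proof.
move=> kM kp kj jJ; have pj := leaf_neq jJ.
have:= groupM (star_word kp kj jJ) kM; rewrite mulgKV => gM.
apply/eqP/negPn/negP=> jj'.
have U : uniq [:: p; j; j'] by all_neq.
three_cycle M3 U gM.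
Qed.

End Star.

Definition pair_swaps_in (T : finType) (k : {perm T}) (M : {set {perm T}}) :=
  forall x y, k x != x -> k y != y -> y != x -> y != k x ->
    tperm x y * tperm (k x) (k y) \in M.

(** Modulo [M] each transposition [(x, g x)] is congruent to [(p r)], and [g] is
    a product of such transpositions: only the parity of their number
    matters. *)
Lemma involution_parity (T : finType) (M : {group {perm T}}) (p r : T)
    (g : {perm T}) :
    (forall x, g (g x) = x) ->
    (forall x, g x != x -> tperm p r * tperm x (g x) \in M) ->
  g \in M \/ tperm p r * g \in M.
Proof.
have [m] := ubnP #|[set x | g x != x]|.
elim: m g => // m IHm g lem gg gM.
case: (pickP [pred x | g x != x]) => [x /= gx | g1]; last first.
  left; suff -> : g = 1 by exact: group1.
  by apply/permP=> x; have /= /negbFE/eqP-> := g1 x; rewrite perm1.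
pose h := tperm x (g x) * g.
have hx : h x = x by rewrite /h permM tpermL gg.
have hgx : h (g x) = g x by rewrite /h permM tpermR.
have hE y : y != x -> y != g x -> h y = g y.
  by move=> yx ygx; rewrite /h permM tpermD // eq_sym.
have hsub y : h y != y -> h y = g y /\ g y != y.
  have [-> | yx] := eqVneq y x; first by rewrite hx eqxx.
  have [-> | ygx] := eqVneq y (g x); first by rewrite hgx eqxx.
  by rewrite hE.
have xgM := gM _ gx.
case: (IHm h).
- rewrite -ltnS; apply: leq_trans lem; rewrite ltnS; apply: proper_card.
  apply/properP; split.
    by apply/subsetP=> y; rewrite !inE => /hsub[].
  by exists x; rewrite !inE ?gx // hx eqxx.
- move=> y; have [-> | yx] := eqVneq y x; first by rewrite !hx.
  have [-> | ygx] := eqVneq y (g x); first by rewrite !hgx.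
  rewrite hE // hE ?gg //.
    by apply: contraNneq ygx => <-; rewrite gg.
  by rewrite (inj_eq perm_inj).
- by move=> y /hsub[-> /gM].
- move=> hM; right; have := groupM xgM hM.
  by rewrite /h !mulgA -(mulgA (tperm p r)) tperm2 mulg1.
move=> hM; left; have := groupM (groupVr xgM) hM.
rewrite /h invMg !tpermV !mulgA -(mulgA (tperm x (g x))) tperm2.
by rewrite mulg1 tperm2 mul1g.
Qed.

(** * The star with all leaves but one *)

Section FullStar.

Variables (T : finType) (M : {group {perm T}}) (p r : T).
Hypotheses (M3 : three_cycle_free M) (rp : r != p) (T5 : 4 < #|T|).

Let J := ~: [set p; r].

Let JE j : (j \in J) = (j != p) && (j != r).
Proof. by rewrite !inE negb_or. Qed.

Let pJ : p \notin J.
Proof. by rewrite JE eqxx. Qed.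

Lemma full_star_fixed_centre k :
  k \in M -> k \in star_group M p J -> k p = p -> k = 1.
Proof.
move=> kM kS kp.
have kJ j : j != p -> j != r -> k j = j.
  move=> jp jr.
  by apply: (star_fixed_leaves_mem M3 pJ kS kM kp) => //; rewrite JE jp jr.
apply/permP=> j; rewrite perm1.
have [-> | jp] := eqVneq j p; first by [].
have [-> {j jp} | jr] := eqVneq j r; last exact: kJ.
apply/eqP/negPn/negP=> krr.
have [krp | krp] := eqVneq (k r) p.
  by case/eqP: rp; apply: (@perm_inj _ k); rewrite krp kp.
by case/eqP: (krr); apply: (@perm_inj _ k); apply: kJ.
Qed.

(** All [u_j] lie in [M]. If [k] moves [p] to [p'], a fixed leaf [j] would make
    [u_j] a three-cycle, and so would the leaf [p'] (or the leaf that [k] sends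
    to [p]) unless [k] swaps [p] and [p']. Then [k ^+ 2] fixes [p], hence is
    trivial. The elements [u_j] generate all other products by conjugation. *)
Lemma full_star_involution k :
    k \in M -> k \in star_group M p J -> k != 1 ->
  [/\ forall x, k (k x) = x, forall x, x != r -> k x != x
    & pair_swaps_in k M].
Proof.
move=> kM kS k1.
have uM p' j j' : k p = p' -> k j = j' -> j != p -> j != r ->
    tperm p j * tperm p' j' \in M.
  move=> kp kj jp jr; have jJ : j \in J by rewrite JE jp.
  by have:= groupM (star_word kS kp kj jJ) kM; rewrite mulgKV.
have fix1 h : h \in M -> h \in star_group M p J -> h p = p -> h = 1.
  exact: full_star_fixed_centre.
move kp: (k p) => p'.
have p'p : p' != p by apply: contraNneq k1 => E; rewrite (fix1 k) // kp.
have kJ j : j != p -> j != r -> k j != j.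
  move=> jp jr; have [-> | jp'] := eqVneq j p'.
    by rewrite -kp (inj_eq perm_inj) kp.
  apply/negP=> /eqP kj; have gM := uM _ _ _ kp kj jp jr.
  have U : uniq [:: p; p'; j] by all_neq.
  three_cycle M3 U gM.
have kp' : k p' = p.
  apply/eqP/negPn/negP=> kp'p; have [p'r | p'r] := eqVneq p' r.
    move ea: (k^-1 p) => a; have ka : k a = p by rewrite -ea permKV.
    have ap : a != p by apply: contraNneq p'p => E; rewrite -kp -{1}E ka.
    have ar : a != r by apply: contraNneq kp'p => E; rewrite p'r -E ka.
    have ap' : a != p' by rewrite p'r.
    have gM := uM _ _ _ kp ka ap ar.
    have U : uniq [:: p; a; p'] by all_neq.
    three_cycle M3 U gM.
  move kp': (k p') kp'p => p'' p''p.
  have p''p' : p'' != p' by rewrite (perm_neq kp' kp).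
  have gM := uM _ _ _ kp kp' p'p p'r.
  have U : uniq [:: p; p'; p''] by all_neq.
  three_cycle M3 U gM.
have kk x : k (k x) = x.
  have: k ^+ 2 = 1.
    by apply: fix1; rewrite ?groupX // expgS expg1 permM kp.
  by move/permP/(_ x); rewrite expgS expg1 permM perm1.
have kne x : x != r -> k x != x.
  by have [-> | xp] := eqVneq x p; [rewrite kp | apply: kJ].
split=> //.
have uM' x : x != p -> x != p' -> k x != x ->
    tperm p x * tperm p' (k x) \in M.
  move=> xp xp' kxx; have [xr | xr] := eqVneq x r; last exact: uM.
  (* There is no leaf [r]: the element for [r] is obtained from the one for
     [k r] by two conjugations, which move [p] and [k p] to another pair and
     back with their roles swapped. *)
  move: xp xp' kxx; rewrite {x}xr => _ rp' krr.
  move kr: (k r) krr => r1 r1r.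
  have kr1 : k r1 = r by rewrite -kr kk.
  have r1p : r1 != p by neq 4.
  have [j] := @exists_notin T [:: p; p'; r; r1] T5.
  rewrite !inE !negb_or => /and4P[jp jp' jr jr1].
  move kj: (k j) => j1; have kj1 : k j1 = j by rewrite -kj kk.
  have j1p : j1 != p by neq 4.
  have j1r : j1 != r by neq 4.
  have j1j : j1 != j by rewrite -kj kJ.
  have U : uniq [:: p; p'; r; r1; j; j1] by all_neq.
  have := groupJ (uM _ _ _ kp kr1 r1p r1r)
    (groupM (uM _ _ _ kp kj jp jr) (uM _ _ _ kp kj1 j1p j1r)).
  by apply: eq_perm_mem; tword_calc U.
move=> x y kxx kyy yx ykx.
have [xp | xp] := eqVneq x p.
  by move: kxx yx ykx; rewrite xp kp => _ yp yp'; apply: uM'.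
have [xp' | xp'] := eqVneq x p'.
  move ky: (k y) kyy => y1 y1y; have ky1 : k y1 = y by rewrite -ky kk.
  rewrite xp' kp' in yx ykx *.
  have y1p : y1 != p by neq 4.
  have y1p' : y1 != p' by neq 4.
  have U : uniq [:: p; p'; y; y1] by all_neq.
  have := uM' _ y1p y1p'; rewrite ky1 eq_sym => /(_ y1y).
  by apply: eq_perm_mem; tword_calc U.
have uxM := uM' _ xp xp' kxx.
move: kxx ykx uxM; move kx: (k x) => x1 x1x yx1 uxM.
have kx1 : k x1 = x by rewrite -kx kk.
move: kyy; move ky: (k y) => y1 y1y; have ky1 : k y1 = y by rewrite -ky kk.
have [yp | yp] := eqVneq y p.
  move: ky ky1 y1y yx yx1; rewrite yp kp => <- _ _ px px1.
  have U : uniq [:: p; p'; x; x1] by all_neq.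
  by move: uxM; apply: eq_perm_mem; tword_calc U.
have [yp' | yp'] := eqVneq y p'.
  move: ky ky1 y1y yx yx1; rewrite yp' kp' => <- _ _ p'x p'x1.
  have x1p : x1 != p by neq 4.
  have := uM' x1 x1p; rewrite kx1 eq_sym p'x1 eq_sym x1x => /(_ isT isT).
  have U : uniq [:: p; p'; x; x1] by all_neq.
  by apply: eq_perm_mem; tword_calc U.
have uyM := uM' _ yp yp'; rewrite ky in uyM.
have U : uniq [:: p; p'; x; x1; y; y1] by all_neq.
have := groupJ (uyM y1y) uxM.
by apply: eq_perm_mem; tword_calc U.
Qed.

(** The quotient for the leaves [b] and [a] is [(p a) (b c)]. Conjugating it
    with [k ^ (p a)], which sends [p] to [b], turns it into [(a b) (c d)]; the
    quotient for [c] and [b] is [(p b) (c d)], and the two share a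
    transposition. *)
Lemma full_star_leaf_path k (a b c d : T) :
    k \in star_group M p J -> k p = p ->
    k a = b -> k b = c -> k c = d ->
    a \in J -> b \in J -> c \in J -> uniq [:: a; b; c; d] -> False.
Proof.
move=> kS kp ka kb kc aJ bJ cJ; rewrite /= !inE !negb_or.
case/and4P=> /and3P[ab ac ad] /andP[bc bd] cd _.
have ap := leaf_neq pJ aJ; have bp := leaf_neq pJ bJ.
have cp := leaf_neq pJ cJ; have dp : d != p by neq 4.
have U : uniq [:: p; a; b; c; d] by all_neq.
have gM := star_quotient kS kp kb ka bJ aJ.
have hM := star_quotient kS kp kc kb cJ bJ.
have kaM := star_conj kS aJ.
have gE : tperm p b * tperm p c * (tperm p b * tperm p a) =
    (tperm p a * tperm b c) ^ tperm p a by tword_calc U.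
have conjE : tperm p b * tperm c d =
    (tperm p a * tperm b c) ^ k by rewrite conjMg !tpermJ kp ka kb kc.
have := groupM (groupJ gM kaM) hM.
rewrite gE -conjJg -conjE => wM.
three_cycle M3 U wM.
Qed.

(** The quotients for the leaves of the cycle only generate a four-group, but
    the quotient for [i] and [a] is a five-cycle that conjugates one of them to
    an element sharing exactly one transposition with another. *)
Lemma full_star_leaf_cycle k (a b c i : T) :
    k \in star_group M p J -> k p = p ->
    k a = b -> k b = c -> k c = a ->
    a \in J -> b \in J -> c \in J -> i \in J -> k i != i ->
    uniq [:: a; b; c; i] -> False.
Proof.
move=> kS kp ka kb kc aJ bJ cJ iJ; move ki: (k i) => i' i'i.
rewrite /= !inE !negb_or => /and4P[/and3P[ab ac ai] /andP[bc bi] ci _].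
have ap := leaf_neq pJ aJ; have bp := leaf_neq pJ bJ.
have cp := leaf_neq pJ cJ; have ip := leaf_neq pJ iJ.
have U : uniq [:: p; a; b; c; i; i'] by all_neq.
have hM := star_quotient kS kp kc kb cJ bJ.
have gM := star_quotient kS kp kb ka bJ aJ.
have fM := star_quotient kS kp ki ka iJ aJ.
have wM := groupM (groupJ gM fM) hM.
three_cycle M3 U wM.
Qed.

(** If [k] fixes [p], then outside [M] it has no fixed or swapped leaves, so it
    sends some leaf along three leaves: either four points are passed, or a
    three-cycle of leaves appears. In degree five [k] may be that three-cycle
    and nothing else, and then it has a conjugate in [M]. *)
Lemma full_star_moved_centre k :
  k \in star_group M p J -> k \notin M -> k p != p.
Proof.
move=> kS kM; apply/negP=> /eqP kp.
have kJ j : j \in J -> k j != j.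
  move=> jJ; apply: contraNneq kM => kj.
  exact: (star_fixed_leaf kS kp kj jJ).
have kk j : j \in J -> k j \in J -> k (k j) != j.
  move=> jJ kjJ; apply/negP=> /eqP kkj.
  by apply: (star_swapped_leaves M3 pJ kS kp (erefl _) kkj);
    rewrite // eq_sym kJ.
have kleaf j : j \in J -> k j != r -> k j \in J.
  rewrite !JE => /andP[jp _] ->; rewrite andbT.
  by rewrite (perm_neq (erefl (k j)) kp).
have [a] : exists a, a \notin [:: p; r; k^-1 r; k^-1 (k^-1 r)].
  exact: exists_notin.
rewrite !inE !negb_or => /and4P[ap ar kar kkar].
have aJ : a \in J by rewrite JE ap.
have bJ : k a \in J.
  by apply: kleaf => //; apply: contraNneq kar => <-; rewrite permK.
have cJ : k (k a) \in J.
  by apply: kleaf => //; apply: contraNneq kkar => <-; rewrite !permK.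
have ab := kJ a aJ; have bc := kJ _ bJ; have cd := kJ _ cJ.
have ac := kk a aJ bJ; have bd := kk _ bJ cJ.
move kc: (k (k (k a))) cd bd => d; move kb: (k (k a)) kc bc ac cJ => c.
move ka: (k a) kb ab bJ => b kb ab bJ kc bc ac cJ cd bd.
have [da | da] := eqVneq d a; last first.
  by apply: (full_star_leaf_path kS kp ka kb kc) => //; all_neq.
rewrite {d}da in kc cd bd *.
have U3 : uniq [:: a; b; c] by all_neq.
have aM := star_conj kS aJ.
case: (pickP [predC [:: p; r; a; b; c]]) => [i | all5].
  rewrite /= !inE !negb_or => /and5P[ip ir ia ib ic].
  have iJ : i \in J by rewrite JE ip.
  by apply: (full_star_leaf_cycle kS kp ka kb kc aJ bJ cJ iJ) => //;
    [apply: kJ | all_neq].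
have bp := leaf_neq pJ bJ; have cp := leaf_neq pJ cJ.
have [br cr] : b != r /\ c != r by move: bJ cJ;
  rewrite !JE => /andP[_ ->] /andP[].
have kr : k r = r.
  have := all5 (k r); rewrite /= !inE => /negbFE.
  have krE x y : k x = y -> x != r -> (k r == y) = false.
    by move=> kx xr; apply: negbTE; rewrite (perm_neq (erefl (k r)) kx) eq_sym.
  rewrite (krE p) // 1?eq_sym // (krE a b) // (krE b c) // (krE c a) //.
  by rewrite !orbF => /eqP.
have kE : k = tperm a b * tperm a c.
  apply/permP=> x; have := all5 x; rewrite /= !inE permM => /negbFE.
  case/or4P=> [/eqP-> | /eqP-> | /eqP-> | /orP[] /eqP->].
  - by rewrite kp !tpermD //; neq 4.
  - by rewrite kr !tpermD //; neq 4.
  - by rewrite ka tpermL tpermD //; neq 4.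
  - by rewrite kb tpermR tpermL.
  by rewrite kc (@tpermD _ a b c) ?tpermR //; neq 4.
rewrite kE in aM; have U : uniq [:: p; a; b; c] by all_neq.
three_cycle M3 U aM.
Qed.

Lemma full_star_centre_inj k :
  k \in star_group M p J -> k p = p -> k = 1.
Proof.
move=> kS kp; have kM : k \in M.
  by apply/negPn/negP=> kM; have := full_star_moved_centre kS kM;
    rewrite kp eqxx.
exact: full_star_fixed_centre kM kS kp.
Qed.

Hypothesis MAlt : M \subset 'Alt_T.

(** For every leaf [x] that [k] moves, the quotient for [x] and [k x] is
    [(p r) (x, k x)]. As [k] is an involution, it follows that [k] or [(p r) k]
    lies in [M], and the latter is odd. *)
Lemma full_star_swapped_centre k :
  k \in star_group M p J -> k p = r -> k r = p -> k \in M.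
Proof.
move=> kS kp kr.
have kk x : k (k x) = x.
  have: k ^+ 2 = 1.
    by apply: full_star_centre_inj; rewrite ?groupX // expgS expg1 permM kp.
  by move/permP/(_ x); rewrite expgS expg1 permM perm1.
have [q qpr] : exists q, q \notin [:: p; r].
  by apply: exists_notin; apply: leq_ltn_trans T5.
have kA : k \in 'Alt_T.
  have qJ : q \in J by rewrite JE; move: qpr; rewrite !inE negb_or.
  have := subsetP MAlt _ (star_conj kS qJ); rewrite !Alt_even.
  by rewrite odd_permJ.
pose g := tperm p r * k.
have gE x : x != p -> x != r -> g x = k x.
  by move=> xp xr; rewrite /g permM tpermD // eq_sym.
have gp : g p = p by rewrite /g permM tpermL kr.
have gr : g r = r by rewrite /g permM tpermR kp.
have gg x : g (g x) = x.
  have [-> | xp] := eqVneq x p; first by rewrite !gp.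
  have [-> | xr] := eqVneq x r; first by rewrite !gr.
  rewrite gE // gE ?kk //.
    by rewrite (perm_neq (erefl (k x)) kr).
  by rewrite (perm_neq (erefl (k x)) kp).
have gM x : g x != x -> tperm p r * tperm x (g x) \in M.
  have [-> | xp] := eqVneq x p; first by rewrite gp eqxx.
  have [-> | xr] := eqVneq x r; first by rewrite gr eqxx.
  rewrite gE //; move kx: (k x) => y yx; have ky : k y = x by rewrite -kx kk.
  have yp : y != p by neq 4.
  have yr : y != r by neq 4.
  have xJ : x \in J by rewrite JE xp.
  have yJ : y \in J by rewrite JE yp.
  have U : uniq [:: p; r; x; y] by all_neq.
  have := star_quotient kS kp kx ky xJ yJ.
  by apply: eq_perm_mem; tword_calc U.
have [gM' | ] := involution_parity gg gM.
  have := subsetP MAlt _ gM'; move: kA; rewrite !Alt_even odd_permM odd_tperm.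
  by rewrite eq_sym rp => /negPf->.
by rewrite /g mulgA tperm2 mul1g.
Qed.

(** The points next to [p] on its cycle give elements [u_j] that move few
    points, and the quotient of two of them is a three-cycle unless that cycle
    closes after three steps. Which two are available depends on where [r]
    lies. *)
Lemma full_star_centre_three_cycle k p1 p2 :
    k \in star_group M p J -> k p = p1 -> k p1 = p2 -> p1 != p -> p2 != p ->
  k p2 = p /\ tperm p p1 * tperm p1 p2 * k^-1 \in M.
Proof.
move=> kS kp kp1 p1p p2p; have p21 : p2 != p1 by neq 4.
have [p1r | p1r] := eqVneq p1 r.
  have p2r : p2 != r by rewrite -p1r.
  have p2J : p2 \in J by rewrite JE p2p.
  move ea: (k^-1 p) => a; have ka : k a = p by rewrite -ea permKV.
  have ap : a != p by neq 4.
  have ap1 : a != p1 by neq 4.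
  have aJ : a \in J by rewrite JE ap -p1r.
  have [ap2 | ap2] := eqVneq a p2.
    rewrite -ap2; split=> //; have := star_word kS kp ka aJ.
    have U : uniq [:: p; p1; a] by all_neq.
    by apply: eq_perm_mem; congr (_ * _); tword_calc U.
  move eb: (k^-1 a) => b; have kb : k b = a by rewrite -eb permKV.
  have bp : b != p by neq 4.
  have bp1 : b != p1 by neq 4.
  have ba : b != a by neq 4.
  have bJ : b \in J by rewrite JE bp -p1r.
  have wM := star_quotient kS kp kb ka bJ aJ.
  have U : uniq [:: p; p1; a; b] by all_neq.
  three_cycle M3 U wM.
have p1J : p1 \in J by rewrite JE p1p.
have uM := star_word kS kp kp1 p1J; split=> //.
have [p2r | p2r] := eqVneq p2 r.
  move ea: (k^-1 p) => a; have ka : k a = p by rewrite -ea permKV.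
  have ap : a != p by neq 4.
  have ap1 : a != p1 by neq 4.
  have [ap2 | ap2] := eqVneq a p2; first by rewrite -ap2.
  have aJ : a \in J by rewrite JE ap -p2r.
  have wM := star_quotient kS kp kp1 ka p1J aJ.
  have U : uniq [:: p; p1; p2; a] by all_neq.
  three_cycle M3 U wM.
have p2J : p2 \in J by rewrite JE p2p.
apply/eqP/negPn/negP; move kp2: (k p2) => p3 p3p.
have wM := star_quotient kS kp kp1 kp2 p1J p2J.
have U : uniq [:: p; p1; p2; p3] by all_neq.
three_cycle M3 U wM.
Qed.

(** Outside [M], the centre lies in a cycle [(p p1 p2)] of [k]; dividing [k] by
    the [u_j] of a point of this cycle gives an element [kappa] of [M] that
    inverts the cycle and agrees with [k] elsewhere. A leaf [j] off the cycle
    that [k] moves gives a five-cycle [f_j] in [M]. In general [f_j ^ kappa] and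
    [f_(k j)] have the same support and their product is a three-cycle; if [k]
    swaps [j] and [k j], then [f_j ^ kappa * f_j ^-1] is one. If there is no
    such leaf, [kappa] itself is a three-cycle. *)
Lemma full_star_mem k : k \in star_group M p J -> k \in M.
Proof.
move=> kS; apply/negPn/negP=> kM.
have := full_star_moved_centre kS kM; move kp: (k p) => p1 p1p.
move kp1: (k p1) => p2.
have p21 : p2 != p1 by neq 4.
have [p2p | p2p] := eqVneq p2 p.
  rewrite {p2}p2p in kp1 p21.
  have [p1r | p1r] := eqVneq p1 r.
    by case/negP: kM; apply: full_star_swapped_centre; rewrite // -p1r.
  have p1J : p1 \in J by rewrite JE p1p.
  have := star_word kS kp kp1 p1J.
  by rewrite [tperm p1 p]tpermC tperm2 mul1g groupV (negPf kM).
have [kp2 uM] := full_star_centre_three_cycle kS kp kp1 p1p p2p.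
have kappaM := groupVr uM; rewrite !invMg invgK !tpermV in kappaM.
have fM j j' : k j = j' -> j \in J ->
    tperm p j * tperm p1 j' * (tperm p1 p2 * tperm p p1) \in M.
  move=> kj jJ; have := groupM (star_word kS kp kj jJ) kappaM.
  by rewrite mulgA mulgKV !mulgA.
have kappaJ a b a' b' : k a = a' -> k b = b' ->
  tperm a b ^ (k * (tperm p1 p2 * tperm p p1)) =
  tperm a' b' ^ (tperm p1 p2 * tperm p p1).
  by move=> <- <-; rewrite conjgM (tpermJ _ _ k).
have noloop j j' : k j = j' -> k j' = j -> j \in J -> j' != j ->
    j != p1 -> j != p2 -> False.
  move=> kj kj' jJ j'j jp1 jp2; have jp := leaf_neq pJ jJ.
  have U : uniq [:: p; p1; p2; j; j'] by all_neq.
  have := groupM (groupJ (fM _ _ kj jJ) kappaM) (groupVr (fM _ _ kj jJ)).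
  rewrite !conjMg (kappaJ _ _ _ _ kp kj) (kappaJ _ _ _ _ kp1 kj').
  rewrite (kappaJ _ _ _ _ kp1 kp2) (kappaJ _ _ _ _ kp kp1) => wM.
  three_cycle M3 U wM.
have nopath j j' : k j = j' -> j \in J -> j' \in J -> j' != j ->
    j != p1 -> j != p2 -> False.
  move=> kj jJ j'J j'j jp1 jp2; have jp := leaf_neq pJ jJ.
  move kj': (k j') => j2; have [j2j | j2j] := eqVneq j2 j.
    by rewrite j2j in kj'; apply: (noloop j j').
  have U : uniq [:: p; p1; p2; j'; j2] by all_neq.
  have := groupM (groupJ (fM _ _ kj jJ) kappaM) (fM _ _ kj' j'J).
  rewrite !conjMg (kappaJ _ _ _ _ kp kj) (kappaJ _ _ _ _ kp1 kj').
  rewrite (kappaJ _ _ _ _ kp1 kp2) (kappaJ _ _ _ _ kp kp1) => wM.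
  three_cycle M3 U wM.
(* Should [k j] be [r], the five-cycle argument is run two steps further on. *)
have kfix j : j != p -> j != p1 -> j != p2 -> j != r -> k j = j.
  move=> jp jp1 jp2 jr; apply/eqP/negPn/negP; move kj: (k j) => j' j'j.
  have jJ : j \in J by rewrite JE jp.
  have j'p : j' != p by neq 4.
  have [j'r | j'r] := eqVneq j' r; last first.
    by apply: (nopath j j'); rewrite // JE j'p.
  move kj': (k j') => l; have [lj | lj] := eqVneq l j.
    by rewrite lj in kj'; apply: (noloop j j').
  have j'p1 : j' != p1 by neq 4.
  have j'p2 : j' != p2 by neq 4.
  have lp : l != p by neq 4.
  have lj' : l != j' by neq 4.
  move kl: (k l) => l'; have l'p : l' != p by neq 4.
  have l'j' : l' != j' by neq 4.
  apply: (nopath l l') => //; first by rewrite JE lp -j'r.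
  - by rewrite JE l'p -j'r.
  - by neq 4.
  - by neq 4.
  by neq 4.
have kfix' x : x != p -> x != p1 -> x != p2 -> k x = x.
  move=> xp xp1 xp2; have [xr | xr] := eqVneq x r; last exact: kfix.
  apply/eqP/negPn/negP; move kx: (k x) => y yx.
  have ky : k y = y by apply: kfix; rewrite -?xr; neq 4.
  by case/eqP: yx; apply: (@perm_inj _ k); rewrite kx ky.
have kE : k = tperm p p1 * tperm p p2.
  apply/permP=> x; rewrite permM; have [-> | xp] := eqVneq x p.
    by rewrite kp tpermL tpermD //; neq 4.
  have [-> | xp1] := eqVneq x p1; first by rewrite kp1 tpermR tpermL.
  have [-> | xp2] := eqVneq x p2.
    by rewrite kp2 (@tpermD _ p p1 p2) ?tpermR //; neq 4.
  by rewrite kfix' // !tpermD //; neq 4.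
rewrite kE in kappaM; have U : uniq [:: p; p1; p2] by all_neq.
three_cycle M3 U kappaM.
Qed.

End FullStar.

(** * Groups containing the even swaps of pairs *)

Section PairSwaps.

Variables (T : finType) (M : {group {perm T}}) (k : {perm T}).
Hypotheses (M3 : three_cycle_free M) (MAlt : M \subset 'Alt_T).
Hypotheses (kM : k \in M) (kk : forall x, k (k x) = x).
Hypothesis kSwap : pair_swaps_in k M.

Lemma pair_swap x x' y y' :
    k x = x' -> k y = y' -> x' != x -> y' != y -> y != x -> y != x' ->
  tperm x y * tperm x' y' \in M.
Proof. by move=> <- <-; apply: kSwap. Qed.

Lemma two_pairs_swapped x x' y y' :
    k x = x' -> k y = y' -> x' != x -> y' != y -> y != x -> y != x' ->
  tperm x x' * tperm y y' \in M.
Proof.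
move=> kx ky x'x y'y yx yx'.
have kx' : k x' = x by rewrite -kx kk.
have ky' : k y' = y by rewrite -ky kk.
have y'x : y' != x by neq 4.
have y'x' : y' != x' by neq 4.
have U : uniq [:: x; x'; y; y'] by all_neq.
have yy' : y != y' by neq 4.
have := groupM (pair_swap kx ky x'x y'y yx yx') (pair_swap kx ky' x'x yy' y'x
  y'x').
by apply: eq_perm_mem; tword_calc U.
Qed.

Lemma tperm_notin x y : x != y -> tperm x y \notin M.
Proof.
move=> xy; apply/negP=> /(subsetP MAlt).
by rewrite Alt_even odd_tperm xy.
Qed.

(** If [g] moved [r], it would conjugate a product of two pairs to an element
    [(r w) (c d)] of [M]. When [c] and [d] form a pair, [(c d) (w w')] is in [M]
    too. Otherwise swapping the pair of [d] with a further pair changes [d]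
    only. Either way two elements share one transposition and their product is a
    three-cycle; if [w] is [k c] or [k d], then [(c d) (k c, k d)] is the second
    one. If there is no further pair, then [k] is a product of three
    transpositions, hence odd. *)
Lemma pair_swaps_fixed_point r :
    4 < #|T| -> k r = r -> (forall x, x != r -> k x != x) ->
  forall g, g \in M -> g r = r.
Proof.
move=> T5 kr kne g gM; apply/eqP/negPn/negP=> grr.
move ez: (g^-1 r) => z; have gz : g z = r by rewrite -ez permKV.
have zr : z != r by apply: contraNneq grr => E; rewrite -{1}E gz.
have := kne _ zr; move kz: (k z) => z' z'z.
have kz' : k z' = z by rewrite -kz kk.
have z'r : z' != r by neq 4.
have [y] : exists y, y \notin [:: r; z; z'].
  by apply: exists_notin; apply: leq_ltn_trans T5.
rewrite !inE !negb_or => /and3P[yr yz yz'].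
have := kne _ yr; move ky: (k y) => y' y'y.
have ky' : k y' = y by rewrite -ky kk.
have y'r : y' != r by neq 4.
have y'z : y' != z by neq 4.
have y'z' : y' != z' by neq 4.
have := groupJ (two_pairs_swapped kz ky z'z y'y yz yz') gM.
rewrite conjMg !tpermJ gz.
move gz': (g z') => w; move gy: (g y) => c; move gy': (g y') => d hM.
have wr : w != r by neq 4.
have cr : c != r by neq 4.
have dr : d != r by neq 4.
have cw : c != w by neq 4.
have dw : d != w by neq 4.
have dc : d != c by neq 4.
have U4 : uniq [:: r; w; c; d] by all_neq.
have := kne _ wr; move kw: (k w) => w' w'w.
have kw' : k w' = w by rewrite -kw kk.
have w'r : w' != r by neq 4.
have := kne _ cr; move kc: (k c) => c' c'c.
have kc' : k c' = c by rewrite -kc kk.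
have c'r : c' != r by neq 4.
have := kne _ dr; move kd: (k d) => d' d'd.
have kd' : k d' = d by rewrite -kd kk.
have d'r : d' != r by neq 4.
have [dc' | dc'] := eqVneq d c'.
  rewrite dc' in hM dw U4; have wc : w != c by neq 4.
  have wc' : w != c' by neq 4.
  have wM := groupM hM (two_pairs_swapped kc kw c'c w'w wc wc').
  have U : uniq [:: r; w; c; c'; w'] by all_neq.
  three_cycle M3 U wM.
have c'd' : d' != c by neq 4.
have cdM : tperm c d * tperm c' d' \in M.
  exact: pair_swap.
have hcM := groupM hM cdM.
have d'c' : d' != c' by neq 4.
have [c'w | c'w] := eqVneq c' w.
  rewrite c'w in hcM d'c'.
  have U : uniq [:: r; w; c; d; d'] by all_neq.
  three_cycle M3 U hcM.
have [d'w | d'w] := eqVneq d' w.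
  rewrite d'w in hcM c'd'.
  have U : uniq [:: r; w; c; d; c'] by all_neq.
  three_cycle M3 U hcM.
have cw' : w' != c by neq 4.
have dw' : w' != d by neq 4.
have c'w' : w' != c' by neq 4.
have d'w' : w' != d' by neq 4.
case: (pickP [predC [:: r; w; w'; c; c'; d; d']]) => [v | all7].
  rewrite !inE !negb_or => /and5P[vr vw vw' vc /and3P[vc' vd vd']].
  have := kne _ vr; move kv: (k v) => v' v'v.
  have kv' : k v' = v by rewrite -kv kk.
  have dvM : tperm d v * tperm d' v' \in M.
    exact: pair_swap.
  have wM := groupM hM (groupJ hM dvM).
  have U : uniq [:: r; w; c; d; d'; v; v'] by all_neq.
  three_cycle M3 U wM.
case/negP: (tperm_notin w'w).
have := groupM kM (two_pairs_swapped kc kd c'c d'd dc dc').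
apply: eq_perm_mem; apply/permP=> x; rewrite !permM; have := all7 x.
rewrite /= !inE => /negbFE.
case/or4P=> [/eqP-> | /eqP-> | /eqP-> | /or4P[] /eqP->];
  rewrite ?kr ?kw ?kw' ?kc ?kc' ?kd ?kd'; by tperm_eval.
Qed.

Hypothesis kfree : forall x, k x != x.

(** For a fixed-point-free involution [k], such a [B] contains exactly one point
    of each orbit of [k]. *)
Definition transversal_of (B : {set T}) := forall x, (k x \in B) = (x \notin B).

Lemma transversal_card (B S : {set T}) :
  transversal_of B -> (forall x, (k x \in S) = (x \in S)) ->
  #|S| = #|S :&: B|.*2.
Proof.
move=> trB kS; rewrite -(cardsID B S) -addnn; congr (_ + _).
rewrite -(card_imset (mem (S :\: B)) (@perm_inj _ k)); apply: eq_card => x.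
rewrite !inE; apply/imsetP/andP => [[y + ->] | [xS xB]].
  by rewrite !inE kS trB => /andP[].
by exists (k x); rewrite ?kk // !inE kS xS trB xB.
Qed.

Lemma exists_transversal : exists B, transversal_of B.
Proof.
exists [set x | enum_rank x < enum_rank (k x)] => x; rewrite !inE kk -leqNgt.
by rewrite ltn_neqAle (inj_eq val_inj) (inj_eq enum_rank_inj) kfree.
Qed.

Lemma transversal_neq B x y : transversal_of B -> x \in B -> k y \in B ->
  x != y.
Proof. by move=> trB xB; rewrite trB; apply: contraNneq => <-. Qed.

Hypothesis T5 : 4 < #|T|.

(** There are at least four pairs, since three would make the even permutation
    [k] a product of three transpositions. *)
Lemma transversal_size B : transversal_of B -> 3 < #|B| /\ #|T| = #|B|.*2.
Proof.
move=> trB; have TE : #|T| = #|B|.*2.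
  rewrite -(setTI B) -transversal_card ?cardsT // => x; rewrite !inE //.
have B2 : 2 < #|B| by rewrite -(ltn_double 2) -TE.
split=> //; rewrite ltn_neqAle B2 andbT; apply/negP=> /eqP B3.
have [a aB _] := @exists_in_notin T B [::] (ltnW (ltnW B2)).
have [b bB] := @exists_in_notin T B [:: a] (ltnW B2).
rewrite inE => ba; have [c cB] := @exists_in_notin T B [:: a; b] B2.
rewrite !inE negb_or => /andP[ca cb].
have Uabc : uniq [:: a; b; c] by all_neq.
have BE x : x \in B -> x \in [:: a; b; c].
  move=> xB; apply/negPn/negP=> xs.
  have sub : {subset x :: [:: a; b; c] <= B}.
    by move=> y; rewrite !inE => /or4P[] /eqP->.
  have /card_uniqP/esym : uniq (x :: [:: a; b; c]) by rewrite cons_uniq xs.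
  by move/subset_leq_card: (introT subsetP sub) => /[swap] /= <-; rewrite -B3.
have nB x y y' : x \in B -> y \in B -> k y = y' -> y' != x.
  by move=> xB yB <-; rewrite eq_sym; apply: (transversal_neq trB); rewrite ?kk.
have := kfree a; move ka: (k a) => a' a'a;
  have ka' : k a' = a by rewrite -ka kk.
have := kfree b; move kb: (k b) => b' b'b;
  have kb' : k b' = b by rewrite -kb kk.
have := kfree c; move kc: (k c) => c' c'c;
  have kc' : k c' = c by rewrite -kc kk.
have ba' : b != a' by rewrite eq_sym; apply: nB ka.
have ca' : c != a' by rewrite eq_sym; apply: nB ka.
have cb' : c != b' by rewrite eq_sym; apply: nB kb.
have ac' : a != c' by rewrite eq_sym; apply: nB kc.
have bc' : b != c' by rewrite eq_sym; apply: nB kc.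
have ab' : a != b' by rewrite eq_sym; apply: nB kb.
have cc' : c != c' by neq 4.
case/negP: (tperm_notin cc').
have := groupM kM (two_pairs_swapped ka kb a'a b'b ba ba').
have all6 x : x \in [:: a; b; c; a'; b'; c'].
  have [xB | xB] := boolP (x \in B).
    by have := BE _ xB; rewrite !inE => /or3P[] /eqP->; rewrite eqxx ?orbT.
  have := BE (k x); rewrite trB => /(_ xB).
  rewrite !inE -(can_eq kk x a') -(can_eq kk x b') -(can_eq kk x c') ka' kb'
    kc'.
  by case/or3P=> ->; rewrite ?orbT.
apply: eq_perm_mem; apply/permP=> x; rewrite !permM; have := all6 x.
rewrite /= !inE.
case/or4P=> [/eqP-> | /eqP-> | /eqP-> | /or3P[] /eqP->];
  rewrite ?ka ?ka' ?kb ?kb' ?kc ?kc'; by tperm_eval.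
Qed.

(** Given [(a b) (c d)] in [M] with [a], [b], [c], [d] in [B], a fifth point [e]
    of [B] could be exchanged for [a], which gives a three-cycle. So [B] has
    four points, and replacing [d] by [k d] helps: an element of the same shape
    on the new set is conjugate to [(a b) (c, k d)], whose product with
    [(a b) (c d)] is a three-cycle. *)
Lemma transversal_pairs_free :
  exists B, transversal_of B /\
    forall a b c d, a \in B -> b \in B -> c \in B -> d \in B ->
      uniq [:: a; b; c; d] -> tperm a b * tperm c d \notin M.
Proof.
have [B trB] := exists_transversal.
case: (pickP [pred u : T * T * T * T | let: (a, b, c, d) := u in
  [&& a \in B, b \in B, c \in B, d \in B, uniq [:: a; b; c; d] &
      tperm a b * tperm c d \in M]]) => [[[[a b] c] d] | noB]; last first.
  exists B; split=> // a b c d aB bB cB dB Uabcd; apply/negP=> gM.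
  have /= := noB (a, b, c, d); rewrite aB bB cB dB gM.
  by move: Uabcd => /= ->.
case/and5P=> aB bB cB dB /andP[Uabcd hM].
move: (Uabcd); rewrite /= !inE !negb_or andbT.
case/and3P=> /and3P[ab ac ad] /andP[bc bd] cd.
have nB x y y' : x \in B -> y \in B -> k y = y' -> y' != x.
  by move=> xB yB <-; rewrite eq_sym; apply: (transversal_neq trB); rewrite ?kk.
have := kfree a; move ka: (k a) => a' a'a;
  have ka' : k a' = a by rewrite -ka kk.
have := kfree b; move kb: (k b) => b' b'b;
  have kb' : k b' = b by rewrite -kb kk.
have := kfree c; move kc: (k c) => c' c'c;
  have kc' : k c' = c by rewrite -kc kk.
have := kfree d; move kd: (k d) => d' d'd;
  have kd' : k d' = d by rewrite -kd kk.
have B4 e : e \in B -> e \in [:: a; b; c; d].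
  move=> eB; apply/negPn/negP; rewrite !inE !negb_or => /and4P[ea eb ec ed].
  have := kfree e; move ke: (k e) => e' e'e;
    have ke' : k e' = e by rewrite -ke kk.
  have ea' : e != a' by rewrite eq_sym; apply: nB ka.
  have sM := pair_swap ka ke a'a e'e ea ea'.
  have ba' : b != a' by rewrite eq_sym; apply: nB ka.
  have ca' : c != a' by rewrite eq_sym; apply: nB ka.
  have da' : d != a' by rewrite eq_sym; apply: nB ka.
  have be' : b != e' by rewrite eq_sym; apply: nB ke.
  have ce' : c != e' by rewrite eq_sym; apply: nB ke.
  have de' : d != e' by rewrite eq_sym; apply: nB ke.
  have U : uniq [:: a; b; c; d; e; a'; e'] by all_neq.
  have wM := groupM hM (groupJ hM sM).
  three_cycle M3 U wM.
have ab' : a != b' by rewrite eq_sym; apply: nB kb.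
have ac' : a != c' by rewrite eq_sym; apply: nB kc.
have ad' : a != d' by rewrite eq_sym; apply: nB kd.
have bc' : b != c' by rewrite eq_sym; apply: nB kc.
have bd' : b != d' by rewrite eq_sym; apply: nB kd.
have cd' : c != d' by rewrite eq_sym; apply: nB kd.
have ca' : c != a' by neq 4.
have cb' : c != b' by neq 4.
have U : uniq [:: a; b; c; d; a'; b'; c'; d'] by all_neq.
have ca_ : c != a by neq 4.
have cb_ : c != b by neq 4.
have sacM := pair_swap ka kc a'a c'c ca_ ca'.
have sbcM := pair_swap kb kc b'b c'c cb_ cb'.
exists (d' |: (B :\ d)); split=> [x|w x y z].
  have [-> | xd] := eqVneq x d.
    by rewrite !inE kd !eqxx /= orbF; apply/esym; neq 4.
  have [-> | xd'] := eqVneq x d'.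
    by rewrite !inE kd' !eqxx /= orbF; apply: negbTE; neq 4.
  have kxd' : k x != d' by rewrite (perm_neq (erefl (k x)) kd).
  have kxd : k x != d by rewrite (perm_neq (erefl (k x)) kd').
  by rewrite !inE trB (negPf kxd') (negPf xd') kxd xd.
have B2E e : e \in d' |: (B :\ d) -> e \in [:: a; b; c; d'].
  rewrite !inE => /orP[-> | /andP[ed /B4]]; first by rewrite !orbT.
  by rewrite !inE (negPf ed) orbF => /or3P[] ->; rewrite ?orbT.
move=> /B2E wB /B2E xB /B2E yB /B2E zB Uwxyz; apply/negP=> gM.
have g1 := groupM gM hM.
have g2 := groupM (groupJ gM sacM) hM.
have g3 := groupM (groupJ gM sbcM) hM.
(* The three conjugates cover the three ways to pair up four points. *)
move: wB xB yB zB; rewrite !inE.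
by case/or4P=> /eqP ?; case/or4P=> /eqP ?; case/or4P=> /eqP ?;
  case/or4P=> /eqP ?;
  subst w x y z; move: Uwxyz;
    rewrite /= !inE ?eqxx ?orbT ?andbF ?andFb //= => _;
  first [three_cycle M3 U g1 | three_cycle M3 U g2 | three_cycle M3 U g3].
Qed.

(** Let [z1 = k c0] and let [z2] be another point off the cycle. The five-cycle
    fixes both, so its powers send [(z1 z2) (c0, k z2)] to elements with the
    same first factor; the power is chosen so that the second factors share one
    point. *)
Lemma five_cycle_escaping c0 c1 c2 c3 c4 :
    uniq [:: c0; c1; c2; c3; c4] -> k c0 \notin [:: c0; c1; c2; c3; c4] ->
    6 < #|T| ->
  tperm c0 c1 * tperm c0 c2 * tperm c0 c3 * tperm c0 c4 \notin M.
Proof.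
move=> Uc z1c T7; apply/negP=> fM; move: z1c Uc; rewrite /= !inE !negb_or.
move kc0: (k c0) => z1 /and5P[z10 z11 z12 z13 z14].
have kz1 : k z1 = c0 by rewrite -kc0 kk.
rewrite andbT => /and4P[/and4P[c01 c02 c03 c04] /and3P[c12 c13 c14] /andP[c23
  c24] c34].
have [z2] := @exists_notin T [:: c0; c1; c2; c3; c4; z1] T7.
rewrite !inE !negb_or => /and5P[z20 z21 z22 z23 /andP[z24 z2z1]].
have := kfree z2; move kz2: (k z2) => y yz2;
  have ky : k y = z2 by rewrite -kz2 kk.
have c0z1 : c0 != z1 by neq 4.
have hM := pair_swap kz1 kz2 c0z1 yz2 z2z1 z20.
have yc0 : y != c0 by neq 4.
have yz1 : y != z1 by neq 4.
have wM1 := groupM hM (groupJ hM fM).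
have wM2 := groupM hM (groupJ hM (groupM fM fM)).
have wM4 := groupM hM (groupJ hM (groupVr fM)).
have wM3 := groupM hM (groupJ hM (groupVr (groupM fM fM))).
have U : uniq [:: c0; c1; c2; c3; c4; z1; z2] by all_neq.
have [y1|y1] := eqVneq y c1; first by (rewrite y1 in wM1; three_cycle M3 U wM1).
have [y2|y2] := eqVneq y c2; first by (rewrite y2 in wM2; three_cycle M3 U wM2).
have [y3|y3] := eqVneq y c3; first by (rewrite y3 in wM3; three_cycle M3 U wM3).
have [y4|y4] := eqVneq y c4; first by (rewrite y4 in wM4; three_cycle M3 U wM4).
have U' : uniq [:: c0; c1; c2; c3; c4; z1; z2; y] by all_neq.
three_cycle M3 U' wM1.
Qed.

(** Five being odd, [k] cannot preserve the support of the cycle, and the cycle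
    may be rotated to start at a point that leaves the support. *)
Lemma pair_swaps_five_cycle c0 c1 c2 c3 c4 :
    uniq [:: c0; c1; c2; c3; c4] ->
  tperm c0 c1 * tperm c0 c2 * tperm c0 c3 * tperm c0 c4 \notin M.
Proof.
move=> Uc; have [B trB] := exists_transversal.
have T7 : 6 < #|T|.
  have [B4 ->] := transversal_size trB.
  by rewrite (leq_ltn_trans _ (_ : 3.*2 < _)) // ltn_double.
have [/forallP kc | ] := boolP [forall x, (x \in [:: c0; c1; c2; c3; c4]) ==>
    (k x \in [:: c0; c1; c2; c3; c4])].
  have cE x : (k x \in [set:: [:: c0; c1; c2; c3; c4]]) =
      (x \in [set:: [:: c0; c1; c2; c3; c4]]).
    apply/idP/idP; rewrite !in_set => xc; last exact: implyP (kc x) xc.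
    by rewrite -(kk x); apply: implyP (kc (k x)) xc.
  have := transversal_card trB cE; rewrite cardsE (card_uniqP Uc) => /esym E.
  by have := odd_double #|[set:: [:: c0; c1; c2; c3; c4]] :&: B|; rewrite E.
rewrite negb_forall => /existsP[x]; rewrite negb_imply => /andP[xc kxc].
have rotE c i : c = seq.rot i [:: c0; c1; c2; c3; c4] -> uniq c /\
    forall y, (y \in c) = (y \in [:: c0; c1; c2; c3; c4]).
  by move=> ->; rewrite rot_uniq; split=> // y; rewrite mem_rot.
have esc d0 d1 d2 d3 d4 i : [:: d0; d1; d2; d3; d4] = seq.rot i [:: c0; c1;
  c2; c3; c4] ->
    x = d0 -> tperm d0 d1 * tperm d0 d2 * tperm d0 d3 * tperm d0 d4 \notin M.
  case/rotE=> Ud dE xd; apply: five_cycle_escaping => //.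
  by rewrite dE -xd.
move: xc; rewrite !inE;
  case/or4P=> [/eqP x0 | /eqP x1 | /eqP x2 | /orP[] /eqP x3].
- exact: (esc _ _ _ _ _ 0).
- apply: (contra _ (esc c1 c2 c3 c4 c0 1%N (erefl _) x1)).
  by apply: eq_perm_mem; tword_calc Uc.
- apply: (contra _ (esc c2 c3 c4 c0 c1 2%N (erefl _) x2)).
  by apply: eq_perm_mem; tword_calc Uc.
- apply: (contra _ (esc c3 c4 c0 c1 c2 3%N (erefl _) x3)).
  by apply: eq_perm_mem; tword_calc Uc.
apply: (contra _ (esc c4 c0 c1 c2 c3 4%N (erefl _) x3)).
by apply: eq_perm_mem; tword_calc Uc.
Qed.

Section PairsFreeTransversal.

Variable B : {set T}.
Hypothesis trB : transversal_of B.
Hypothesis BM : forall a b c d, a \in B -> b \in B -> c \in B -> d \in B ->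
  uniq [:: a; b; c; d] -> tperm a b * tperm c d \notin M.

(** Let [g] move [x] to [y]. Conjugating [(x y) (k x, k y)] by [g] leaves the
    second factor alone, which forces [g] to swap [x] and [y]. For another point
    [z] off [B], the same comparison with [(x z) (k x, k z)] leaves
    [(x z) (y, g z)], and [k] conjugates it to an element with all entries in
    [B]. *)
Lemma fixes_transversal g : g \in M -> {in B, forall b, g b = b} -> g = 1.
Proof.
move=> gM gB; have [B4 _] := transversal_size trB.
apply/permP=> x; rewrite perm1; apply/eqP/negPn/negP; move gx: (g x) => y yx.
have xB : x \notin B by apply: contraNN yx => /gB; rewrite gx => ->.
have yB : y \notin B by apply: contraNN yx => /gB; rewrite -gx => /perm_inj ->.
have gfix b : b \in B -> forall h, g b = h -> h = b by move=> /gB-> h.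
have := kfree x; move kx: (k x) => x1 x1x;
  have kx1 : k x1 = x by rewrite -kx kk.
have := kfree y; move ky: (k y) => y1 y1y;
  have ky1 : k y1 = y by rewrite -ky kk.
have x1B : x1 \in B by rewrite -kx trB.
have y1B : y1 \in B by rewrite -ky trB.
have nB b c : b \in B -> c \notin B -> c != b by move=> bB;
  apply: contraNneq => ->.
have yx1 := nB _ _ x1B yB; have xy1 := nB _ _ y1B xB.
have gx1 := gB _ x1B; have gy1 := gB _ y1B.
have gE a b a' b' : g a = a' -> g b = b' -> tperm a b ^ g = tperm a' b'.
  by move=> <- <-; rewrite tpermJ.
have hM := pair_swap kx ky x1x y1y yx yx1.
have gy : g y = x.
  apply/eqP/negPn/negP; move gy: (g y) => y2 y2x.
  have y2y : y2 != y by neq 4.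
  have y2B : y2 \notin B.
    by apply: contraNN yB => y2B; rewrite -(@perm_inj _ g y2 y) // gy gB.
  have y2x1 := nB _ _ x1B y2B; have y2y1 := nB _ _ y1B y2B.
  have := groupM hM (groupJ hM gM).
  rewrite conjMg (gE _ _ _ _ gx gy) (gE _ _ _ _ gx1 gy1) => wM.
  have U : uniq [:: x; y; y2; x1; y1] by all_neq.
  three_cycle M3 U wM.
have [z1 z1B] := @exists_in_notin T B [:: x1; y1] (ltnW B4).
rewrite !inE negb_or => /andP[z1x1 z1y1].
have := kfree z1; move kz1: (k z1) => z zz1;
  have kz : k z = z1 by rewrite -kz1 kk.
have zB : z \notin B by rewrite -kz1 trB z1B.
have zx : z != x by neq 4.
have zy : z != y by neq 4.
have zx1 := nB _ _ x1B zB; have zy1 := nB _ _ y1B zB.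
have xz1 := nB _ _ z1B xB; have yz1 := nB _ _ z1B yB.
have z1z : z1 != z by neq 4.
have gz1 := gB _ z1B; move gz: (g z) => w.
have wB : w \notin B.
  by apply: contraNN zB => wB; rewrite -(@perm_inj _ g w z) // gz gB.
have wx : w != x by neq 4.
have wy : w != y by neq 4.
have wx1 := nB _ _ x1B wB; have wy1 := nB _ _ y1B wB.
have wz1 := nB _ _ z1B wB.
have lM := pair_swap kx kz x1x z1z zx zx1.
have := groupM lM (groupJ lM gM).
rewrite conjMg (gE _ _ _ _ gx gz) (gE _ _ _ _ gx1 gz1) => wM.
have [wz | wz] := eqVneq w z.
  rewrite wz in wM; have U : uniq [:: x; y; z; x1; z1] by all_neq.
  three_cycle M3 U wM.
have := kfree w; move kw: (k w) => w1 w1w;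
  have kw1 : k w1 = w by rewrite -kw kk.
have w1B : w1 \in B by rewrite -kw trB.
have w1x1 : w1 != x1 by neq 4.
have w1y1 : w1 != y1 by neq 4.
have w1z1 : w1 != z1 by neq 4.
have z1x1' : z1 != x1 by neq 4.
have U4 : uniq [:: x1; z1; y1; w1] by all_neq.
case/negP: (BM x1B z1B y1B w1B U4).
have U : uniq [:: x; y; z; w; x1; z1] by all_neq.
have <- : (tperm x z * tperm y w) ^ k = tperm x1 z1 * tperm y1 w1.
  by rewrite conjMg !tpermJ kx ky kz kw.
by apply: groupJ kM; move: wM; apply: eq_perm_mem; tword_calc U.
Qed.

(** If [g] is in [M] it fixes all leaves. If not, any two leaves are adjacent in
    the graph of [g], since the quotient of two others is a five-cycle. So three
    leaves form a three-cycle of [g], and then a quotient is a product of two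
    transpositions with entries in [B]. *)
Lemma transversal_star_centre_inj p g :
  p \in B -> g \in star_group M p (B :\ p) -> g p = p -> g = 1.
Proof.
move=> pB gS gp; have [B4 _] := transversal_size trB.
have pJ : p \notin B :\ p by rewrite !inE eqxx.
have gM : g \in M; last first.
  apply: fixes_transversal => // b bB; have [-> // | bp] := eqVneq b p.
  have bJ : b \in B :\ p by rewrite !inE bp.
  exact: (star_fixed_leaves_mem M3 pJ gS gM gp (erefl _) bJ).
apply/negPn/negP=> gM.
have gJ j : j \in B :\ p -> g j != j.
  by move=> jJ; apply: contraNneq gM => gj;
    apply: (star_fixed_leaf gS gp gj jJ).
have link i j : i \in B :\ p -> j \in B :\ p -> i != j ->
  (g i == j) || (g j == i).
  move=> iJ jJ ij; apply/negPn/negP; rewrite negb_or.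
  have := gJ _ iJ; have := gJ _ jJ; move gi: (g i) => i'; move gj: (g j) => j'.
  move=> j'j i'i /andP[i'j j'i].
  have ip := leaf_neq pJ iJ; have jp := leaf_neq pJ jJ.
  have U : uniq [:: p; i; i'; j'; j] by all_neq.
  case/negP: (pair_swaps_five_cycle U).
  by have := star_quotient gS gp gi gj iJ jJ; apply: eq_perm_mem; tword_calc U.
have cyc a b c : a \in B :\ p -> b \in B :\ p -> c \in B :\ p ->
    uniq [:: a; b; c] -> g a = b -> False.
  move=> aJ bJ cJ; rewrite /= !inE negb_or andbT => /andP[/andP[ab ac] bc] ga.
  have gb : g b = c.
    have /orP[/eqP-> // | /eqP gc] := link b c bJ cJ bc.
    by case/eqP: ac; apply: (@perm_inj _ g); rewrite ga gc.
  have gc : g c = a.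
    have /orP[/eqP gac | /eqP-> //] := link a c aJ cJ ac.
    by case/eqP: bc; rewrite -ga gac.
  have ap := leaf_neq pJ aJ; have bp := leaf_neq pJ bJ;
    have cp := leaf_neq pJ cJ.
  have U : uniq [:: p; a; b; c] by all_neq.
  move: aJ bJ cJ; rewrite !inE => /andP[_ aB] /andP[_ bB] /andP[_ cB].
  case/negP: (BM pB aB bB cB U).
  have := star_quotient gS gp gb ga; rewrite !inE bp bB ap aB => /(_ isT isT).
  by apply: eq_perm_mem; tword_calc U.
have [b bB] := @exists_in_notin T B [:: p] (ltnW (ltnW B4)).
rewrite inE => bp; have [c cB] := @exists_in_notin T B [:: p; b] (ltnW B4).
rewrite !inE negb_or => /andP[cp cb].
have [d dB] := @exists_in_notin T B [:: p; b; c] B4.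
rewrite !inE !negb_or => /and3P[dp db dc].
have bJ : b \in B :\ p by rewrite !inE bp.
have cJ : c \in B :\ p by rewrite !inE cp.
have dJ : d \in B :\ p by rewrite !inE dp.
have bc : b != c by neq 4.
have /orP[/eqP | /eqP] := link b c bJ cJ bc.
  by apply: (cyc b c d) => //; all_neq.
by apply: (cyc c b d) => //; all_neq.
Qed.

End PairsFreeTransversal.

End PairSwaps.

(** * Conjugates that meet trivially *)

Section Bases.

Variables (T : finType).
Hypothesis T5 : 4 < #|T|.

Definition conjugates_meet_trivially (K L : {set {perm T}})
    (s : seq {perm T}) : Prop :=
  {subset s <= 'Alt_T} /\
  forall g, g \in K -> (forall x, x \in s -> g \in L :^ x) -> g = 1.

Lemma Alt_normal_sub (N : {group {perm T}}) :
  N <| 'Alt_T -> N :=: 1 \/ N :=: 'Alt_T.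
Proof. by have /simpleP[_] := simple_Alt5 T5; apply. Qed.

Lemma conjugate_not_containing (K L : {group {perm T}}) :
  L \proper 'Alt_T -> K != 1%G ->
    exists2 x, x \in 'Alt_T & ~~ (K \subset L :^ x).
Proof.
move=> prL K1; apply/exists_inP; rewrite -negb_forall_in; apply/negP.
move/forall_inP=> KL.
have [core1 | coreAlt] : gcore L 'Alt_T = 1 \/ gcore L 'Alt_T = 'Alt_T.
- apply: (@Alt_normal_sub (gcore_group L 'Alt_T)).
  by rewrite /normal gcore_norm (subset_trans (gcore_sub _ _)) ?proper_sub.
- case/negP: K1; rewrite -val_eqE /= -subG1 -core1.
  by apply/bigcapsP=> x; apply: KL.
by case/negP: (proper_subn prL); rewrite -{1}coreAlt gcore_sub.
Qed.

(** Each conjugate that does not contain the group at least halves its order. *)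
Lemma small_group_base (L : {group {perm T}}) (c : nat) (K : {group {perm T}}) :
    L \proper 'Alt_T -> #|K| < 2 ^ c.+1 ->
  exists2 s, size s <= c & conjugates_meet_trivially K L s.
Proof.
move=> prL; elim: c K => [|c IHc] K ltK.
  exists [::] => //; split=> // g gK _; apply/set1gP.
  by rewrite -(card_le1_trivg _ : K :=: 1) // -ltnS.
have [-> | K1] := eqVneq K 1%G.
  by exists [::] => //; split=> // g /set1gP.
have [x xA Kx] := conjugate_not_containing prL K1.
have [|s les [sA sK]] := IHc (K :&: (L :^ x))%G.
  rewrite -(ltn_pmul2r (isT : 0 < 2)) -expnSr.
  apply: leq_ltn_trans ltK; rewrite -(Lagrange (subsetIl K (L :^ x))) leq_mul2l.
  by rewrite indexg_gt1 subsetI subxx Kx orbT.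
exists (x :: s) => //; split=> [y | g gK gs].
  by rewrite inE => /predU1P[-> | /sA].
apply: sK => [|y ys]; last by apply: gs; rewrite inE ys orbT.
by rewrite inE gK gs ?mem_head.
Qed.

Section StarConjugators.

Variables (L M : {group {perm T}}) (u v : T).
Hypotheses (uv : u != v) (ML : M :=: L :^ tperm u v).

Definition star_conjugators (p : T) (J : {set T}) : seq {perm T} :=
  [seq tperm u v * tperm p j | j <- enum J].

Lemma star_conjugators_Alt p (J : {set T}) :
  p \notin J -> {subset star_conjugators p J <= 'Alt_T}.
Proof.
move=> pJ x /mapP[j]; rewrite mem_enum => jJ ->.
rewrite Alt_even odd_permM !odd_tperm uv.
by rewrite (_ : p != j) //; apply: contraNneq pJ => ->.
Qed.

Lemma star_conjugatorsP p J g :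
    (forall x, x \in star_conjugators p J -> g \in L :^ x) ->
  g \in star_group M p J.
Proof.
move=> gs; apply/bigcapP=> j jJ; rewrite /= ML -conjsgM; apply: gs.
by apply/mapP; exists j; rewrite ?mem_enum.
Qed.

Lemma involution_base (k : {perm T}) :
    three_cycle_free M -> L \proper 'Alt_T -> k \in M ->
      (forall x, k (k x) = x) ->
    pair_swaps_in k M -> (forall x, k x != x) ->
  exists2 s, size s <= #|T| - 2 & conjugates_meet_trivially 'Alt_T L s.
Proof.
move=> M3 prL kM kk kSwap kfree.
have MAlt : M \subset 'Alt_T.
  apply/subsetP=> x; rewrite ML mem_conjg => /(subsetP (proper_sub prL)).
  by rewrite !Alt_even odd_permJ.
have [B [trB BM]] := transversal_pairs_free M3 kk kSwap kfree.
have [B4 TE] := transversal_size MAlt kM kk kSwap kfree T5 trB.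
have [p pB _] := @exists_in_notin T B [::] (ltnW (ltnW (ltnW B4))).
have pJ : p \notin B :\ p by rewrite !inE eqxx.
have inj1 := transversal_star_centre_inj M3 MAlt kM kk kSwap kfree T5 trB BM pB.
have [|s les [sA sK]] := @small_group_base L (#|B|.-1) (star_group M p (B :\
  p)) prL.
  rewrite prednK ?(leq_trans _ B4) //.
  apply: leq_ltn_trans (double_lt_exp2 (ltnW B4)); rewrite -TE.
  rewrite -(card_in_imset (f := fun g : {perm T} => g p)) ?max_card //.
  move=> g h gS hS /= ghp; apply/(mulIg h^-1)/esym; rewrite mulgV; apply/esym.
  by apply: inj1; rewrite ?groupM ?groupV // permM ghp permK.
exists (star_conjugators p (B :\ p) ++ s).
  rewrite size_cat size_map -cardE.
  have cB : #|B| = #|B :\ p|.+1 by rewrite (cardsD1 p) pB.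
  by move: les; rewrite TE cB doubleS !subSS subn0 -addnn leq_add2l.
split=> [x | g gA gs].
  by rewrite mem_cat => /orP[/star_conjugators_Alt->|/sA].
apply: sK => [|x xs]; last by apply: gs; rewrite mem_cat xs orbT.
by apply: star_conjugatorsP => x xs; apply: gs; rewrite mem_cat xs.
Qed.
End StarConjugators.

End Bases.

(** * Subgroups preserving an equivalence relation *)

Section EquivalenceBase.

Variables (T : finType) (L : {group {perm T}}) (e : rel T).
Hypotheses (ee : equivalence_rel e).
Hypothesis eL : forall g, g \in L -> forall x y, e (g x) (g y) = e x y.

Lemma equivalence_left x y : e x y -> e x =1 e y.
Proof. by move=> xy z; case: (ee x y z) => _ /(_ xy). Qed.

Lemma equivalence_refl x : e x x.
Proof. by case: (ee x x x). Qed.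

Lemma equivalence_sym x y : e x y = e y x.
Proof.
by apply/idP/idP=> xy; rewrite -(equivalence_left xy) equivalence_refl.
Qed.

Lemma equivalence_conjg x g : g \in L :^ x ->
  forall a b, e (x^-1 (g a)) (x^-1 (g b)) = e (x^-1 a) (x^-1 b).
Proof.
rewrite mem_conjg => gL a b; have := eL gL (x^-1 a) (x^-1 b).
by rewrite conjgE invgK !permM !permKV.
Qed.

Variables (p q r : T).
Hypotheses (C3 : 2 < #|[set x | e p x]|) (pq : ~~ e p q).
Hypothesis rp : r != p.
Hypothesis qr : e q r \/ (forall b, e q b -> b = q).

(** The shift by [i] replaces [i] by [q] in the class of [p] if [i] belongs to
    that class; otherwise it replaces [p] by [i] there. *)
Definition class_shift (i : T) : {perm T} :=
  if e p i then tperm p i * tperm q i else tperm p q * tperm q i.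

Variable k : {perm T}.
Hypotheses (kA : k \in 'Alt_T) (kL : k \in L).
Hypothesis kx : forall i, i \notin [:: p; q; r] -> k \in L :^ class_shift i.

Let qp : q != p. Proof. by apply: contraNneq pq => ->;
  exact: equivalence_refl. Qed.

Let class_neq_q a : e p a -> a != q.
Proof. by move=> pa; apply: contraNneq pq => <-. Qed.

Lemma class_shift_eq i : i \notin [:: p; q; r] ->
  forall a b, e ((class_shift i)^-1 (k a)) ((class_shift i)^-1 (k b)) =
              e ((class_shift i)^-1 a) ((class_shift i)^-1 b).
Proof. by move/kx/equivalence_conjg. Qed.

(** The point [i] has class-mates, but none of them is equivalent to it in the
    shifted relation. This property is preserved by [k]. The only points having
    it are [i] and, if its class is not a singleton, [q]; also the other point
    of the class of [q] if there is just one. The last possibility is excluded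
    by counting, as [k] would send three points of the class of [p] to the class
    of [q]. *)
Lemma shifted_point_image i : e p i -> i != p -> i != r ->
  k i = i \/ k i = q /\ e q r.
Proof.
move=> pi ip ir; have iq := class_neq_q pi.
have := @class_shift_eq i; rewrite !inE !negb_or ip iq ir => /(_ isT).
rewrite /class_shift pi invMg !tpermV; set f := tperm q i * tperm p i => ef.
have fi : f i = q by rewrite permM; tperm_eval.
have fE a : a != p -> a != q -> a != i -> f a = a.
  by move=> ap aq ai; rewrite permM; tperm_eval.
have fp a : e p a -> a != i -> e p (f a).
  move=> pa ai; have aq := class_neq_q pa.
  have [-> | ap] := eqVneq a p; last by rewrite fE.
  by rewrite permM; tperm_eval.
have fn a : ~~ e p a -> a != q -> f a = a.
  by move=> pa aq; apply: fE => //; apply: contraNneq pa => ->;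
    rewrite ?equivalence_refl.
have iso b : b != k i -> e (k i) b -> ~~ e (f (k i)) (f b).
  rewrite -[b](permKV k) (inj_eq perm_inj) eL // ef fi;
    set c := k^-1 b => ci ic.
  have pc : e p c by rewrite (equivalence_left pi).
  by rewrite equivalence_sym -(equivalence_left (fp c pc ci)).
have kpi : e (k i) (k p) by rewrite eL // equivalence_sym.
have kne : k p != k i by rewrite (inj_eq perm_inj) eq_sym.
have [-> | ki] := eqVneq (k i) i; [by left | right].
have pki : ~~ e p (k i).
  apply/negP=> pki; have [c] := @exists_in_notin _ _ [:: k i; i] C3.
  rewrite !inE negb_or => pc /andP[cki ci].
  have := iso c cki; rewrite -(equivalence_left pki) pc => /(_ isT).
  by rewrite -(equivalence_left (fp _ pki ki)) fp.
have pkp : ~~ e p (k p) by rewrite equivalence_sym -(equivalence_left kpi)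
  equivalence_sym.
have kiq : e q (k i).
  have [-> | kiq] := eqVneq (k i) q; first exact: equivalence_refl.
  have [<- | kpq] := eqVneq (k p) q; first by rewrite equivalence_sym.
  by have := iso _ kne kpi; rewrite !fn // kpi.
have eqr : e q r.
  case: qr => // q1; case/eqP: kne.
  by rewrite (q1 _ kiq) (q1 (k p)) // (equivalence_left kiq).
split=> //; apply/eqP/negPn/negP=> kinq.
have [c] := @exists_in_notin _ _ [:: p; i] C3;
  rewrite !inE negb_or => pc /andP[cp ci].
have kic : e (k i) (k c) by rewrite eL // -(equivalence_left pi).
have far b : e (k i) b -> b != k i -> b != q -> False.
  move=> kib bki bq; have := iso _ bki kib; rewrite !fn ?kib //.
  by rewrite equivalence_sym -(equivalence_left kib) equivalence_sym.
have [kpq | kpq] := eqVneq (k p) q; last exact: (far (k p)).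
apply: (far (k c)) => //; rewrite ?(inj_eq perm_inj) //.
by rewrite -kpq (inj_eq perm_inj).
Qed.

(** Two points of the class of [p] cannot both be sent to [q]. If [r] is in the
    class of [q], then a second point besides [p] is available. *)
Lemma class_fixed i : e p i -> i != p -> i != r -> k i = i.
Proof.
move=> pi ip ir; have [// | [kiq eqr]] := shifted_point_image pi ip ir.
have [c] := @exists_in_notin _ _ [:: p; i] C3;
  rewrite !inE negb_or => pc /andP[cp ci].
have cr : c != r.
  by apply: contraNneq pq => E;
    rewrite equivalence_sym (equivalence_left eqr) -E equivalence_sym.
have [kc | [kcq _]] := shifted_point_image pc cp cr; last first.
  by case/eqP: ci; apply: (@perm_inj _ k); rewrite kcq kiq.
have := eL kL c i; rewrite kc kiq -(equivalence_left pc) -(equivalence_left pc)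
  pi.
by rewrite (negPf pq).
Qed.

(** A fixed point [i] in the class of [p] pins down this class and all its
    shifts as sets, and each shift brings in just one new point, which is
    therefore fixed. Only [p] and [r] are left, and [k] is even. *)
Lemma class_shift_trivial : k = 1.
Proof.
have [i] := @exists_in_notin _ _ [:: p; r] C3.
rewrite !inE negb_or => pi /andP[ip ir]; have iq := class_neq_q pi.
have ki := class_fixed pi ip ir.
have kp a : e p (k a) = e p a by rewrite !(equivalence_left pi) -{1}ki eL.
have kout a : ~~ e p a -> a != q -> a != r -> k a = a.
  move=> pa aq ar; have ap : a != p by apply: contraNneq pa => ->;
    rewrite equivalence_refl.
  have ia : i != a by apply: contraNneq pa => <-.
  have := @class_shift_eq a; rewrite !inE !negb_or ap aq ar => /(_ isT i a).
  rewrite /class_shift (negPf pa) invMg !tpermV ki !permM.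
  have -> : tperm p q (tperm q a i) = i by tperm_eval.
  have -> : tperm p q (tperm q a a) = p by tperm_eval.
  rewrite -!(equivalence_left pi) equivalence_refl.
  have [-> // | kaa] := eqVneq (k a) a.
  have [kaq | kaq] := eqVneq (k a) q.
    by rewrite kaq tpermL tpermD ?(negPf pa) //; neq 4.
  have kap : k a != p.
    by apply: contraNneq pa => E; rewrite -kp E equivalence_refl.
  by rewrite (@tpermD _ q a) 1?eq_sym // tpermD ?kp ?(negPf pa) // eq_sym.
have kq : k q = q.
  have := @class_shift_eq i; rewrite !inE !negb_or ip iq ir => /(_ isT p q).
  rewrite /class_shift pi invMg !tpermV !permM.
  have -> : tperm p i (tperm q i p) = i by tperm_eval.
  have -> : tperm p i (tperm q i q) = p by tperm_eval.
  rewrite [e i p]equivalence_sym pi.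
  have pkp : e p (k p) by rewrite kp equivalence_refl.
  have kpi : k p != i by rewrite (perm_neq (erefl (k p)) ki) eq_sym.
  have kpq := class_neq_q pkp.
  rewrite (@tpermD _ q i (k p)) 1?eq_sym //.
  have kqi : k q != i by rewrite (perm_neq (erefl (k q)) ki) eq_sym.
  have pkq : ~~ e p (k q) by rewrite kp.
  have kqp : k q != p by apply: contraNneq pkq => ->; rewrite equivalence_refl.
  have pf : e p (tperm p i (k p)).
    have [-> | kpp] := eqVneq (k p) p; first by rewrite tpermL.
    by rewrite tpermD // eq_sym.
  rewrite -(equivalence_left pf); have [// | kqq] := eqVneq (k q) q.
  by rewrite (@tpermD _ q i) 1?eq_sym // tpermD 1?eq_sym // (negPf pkq).
have kfix a : a != p -> a != r -> k a = a.
  move=> ap ar; have [pa | pa] := boolP (e p a); first exact: class_fixed.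
  by have [-> | aq] := eqVneq a q; last exact: kout.
have [kpp | kpp] := eqVneq (k p) p.
  apply/permP=> a; rewrite perm1; have [-> // | ap] := eqVneq a p.
  have [-> | ar] := eqVneq a r; last exact: kfix.
  apply/eqP/negPn/negP=> krr.
  have krp : k r != p by rewrite (perm_neq (erefl (k r)) kpp).
  by case/eqP: (krr); apply: (@perm_inj _ k); rewrite kfix.
have kpr : k p = r.
  apply/eqP/negPn/negP=> kpr.
  by case/eqP: (kpp); apply: (@perm_inj _ k); rewrite kfix.
have krp : k r = p.
  apply/eqP/negPn/negP=> krp.
  have krr : k r != r by rewrite (perm_neq (erefl (k r)) kpr).
  by case/eqP: (krr); apply: (@perm_inj _ k); rewrite kfix.
have kE : k = tperm p r.
  apply/permP=> a; have [-> | ap] := eqVneq a p; first by rewrite tpermL.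
  have [-> | ar] := eqVneq a r; first by rewrite tpermR.
  by rewrite kfix // tpermD // eq_sym.
by move: kA; rewrite kE Alt_even odd_tperm eq_sym rp.
Qed.

End EquivalenceBase.

Lemma equivalence_base (T : finType) (L : {group {perm T}}) (e : rel T) p q :
    4 < #|T| -> equivalence_rel e ->
    (forall g, g \in L -> forall x y, e (g x) (g y) = e x y) ->
    2 < #|[set x | e p x]| -> ~~ e p q ->
  exists2 s, size s <= #|T| - 2 & conjugates_meet_trivially 'Alt_T L s.
Proof.
move=> T5 ee eL C3 pq.
have qp : q != p by apply: contraNneq pq => ->; apply: equivalence_refl ee _.
have [r [rp rq qr]] : exists r, [/\ r != p, r != q &
    e q r \/ (forall b, e q b -> b = q)].
  case: (pickP [pred r | e q r && (r != q)]) => [r /= /andP[qr rq] | q1].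
    exists r; split=> //; last by left.
    by apply: contraNneq pq => <-; rewrite (equivalence_sym ee).
  have [r] := @exists_notin T [:: p; q] (ltnW (ltnW T5)).
  rewrite !inE negb_or => /andP[rp rq]; exists r; split=> //; right=> b qb.
  by apply/eqP/negPn; have /= := q1 b; rewrite qb => /negbT.
pose A := ~: [set p; q; r].
exists (1 :: [seq class_shift e p q i | i <- enum A]).
  have := cardsC [set p; q; r].
  rewrite setUC cardsU1 cards2 !inE negb_or rp rq eq_sym qp setUC -/A => <-.
  by rewrite /= size_map -cardE.
split=> [x | k kA ks].
  rewrite inE => /predU1P[-> | /mapP[i]]; first exact: group1.
  rewrite mem_enum => iA ->.
  have [ip iq] : i != p /\ i != q by move: iA;
    rewrite !inE !negb_or => /andP[/andP[]].
  rewrite /class_shift; case: ifP => _; rewrite Alt_even odd_permM !odd_tperm.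
    by rewrite ![_ == i]eq_sym ip iq.
  by rewrite ![_ == i]eq_sym iq eq_sym qp.
have kL : k \in L by have := ks 1; rewrite inE eqxx conjsg1; apply.
apply: (class_shift_trivial ee eL C3 pq rp qr kA kL) => i iA.
apply: ks; rewrite inE; apply/orP; right; apply/mapP; exists i => //.
by rewrite mem_enum; move: iA; rewrite !inE !negb_or andbA.
Qed.

(** * Subgroups containing a three-cycle *)

Section ThreeCycles.

Variables (T : finType) (L : {group {perm T}}).

Definition three_cycle_related (a b : T) : bool :=
  (a == b) || [exists c, uniq [:: a; b; c] && (tperm a b * tperm a c \in L)].

Lemma three_cycle_relatedP a b : a != b ->
  reflect (exists2 c, uniq [:: a; b; c] & tperm a b * tperm a c \in L)
          (three_cycle_related a b).
Proof.
move=> ab; rewrite /three_cycle_related (negPf ab).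
by apply: (iffP existsP) => [[c /andP[]] | [c]]; exists c => //; apply/andP.
Qed.

Lemma three_cycle_relatedI a b c :
  uniq [:: a; b; c] -> tperm a b * tperm a c \in L -> three_cycle_related a b.
Proof.
by move=> U gL; rewrite /three_cycle_related; apply/orP; right; apply/existsP;
  exists c; rewrite U.
Qed.

Lemma three_cycle_related_sym a b :
  three_cycle_related a b -> three_cycle_related b a.
Proof.
have [-> // | ab] := eqVneq a b.
case/(three_cycle_relatedP ab)=> c Uabc gL.
apply: (@three_cycle_relatedI _ _ c); last first.
  by have := groupVr gL; apply: eq_perm_mem; tword_calc Uabc.
by move: Uabc; rewrite /= !inE !negb_or andbT => /andP[/andP[? ?] ?]; all_neq.
Qed.

Lemma three_cycle_related_trans a b d :
  three_cycle_related a b -> three_cycle_related b d -> three_cycle_related a d.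
Proof.
have [-> // | ab] := eqVneq a b; have [-> // | bd] := eqVneq b d.
have [-> | ad] := eqVneq a d; first by rewrite /three_cycle_related eqxx.
case/(three_cycle_relatedP ab)=> c Uabc gL.
case/(three_cycle_relatedP bd)=> f Ubdf hL.
move: (Uabc) (Ubdf); rewrite /= !inE !negb_or !andbT.
case/andP=> /andP[_ ac] bc /andP[/andP[_ bf] df].
have [dc | dc] := eqVneq d c.
  apply: (@three_cycle_relatedI _ _ b); first by all_neq.
  by rewrite dc; have := groupVr gL; apply: eq_perm_mem; tword_calc Uabc.
have [fa | fa] := eqVneq f a.
  rewrite fa in hL Ubdf; apply: (@three_cycle_relatedI _ _ b); first by all_neq.
  by have := groupVr hL; apply: eq_perm_mem; tword_calc Ubdf.
have := groupJ gL hL; have [fc | fc] := eqVneq f c => kL.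
  rewrite fc in kL; have U : uniq [:: a; b; c; d] by all_neq.
  apply: (@three_cycle_relatedI _ _ b); first by all_neq.
  by move: kL; apply: eq_perm_mem; tword_calc U.
have U : uniq [:: a; b; c; d; f] by all_neq.
apply: (@three_cycle_relatedI _ _ c); first by all_neq.
by move: kL; apply: eq_perm_mem; tword_calc U.
Qed.

Lemma three_cycle_related_equiv : equivalence_rel three_cycle_related.
Proof.
move=> x y z; split; first by rewrite /three_cycle_related eqxx.
move=> xy; apply/idP/idP; last exact: three_cycle_related_trans.
exact/three_cycle_related_trans/three_cycle_related_sym.
Qed.

Lemma three_cycle_related_perm g : g \in L ->
  forall x y, three_cycle_related (g x) (g y) = three_cycle_related x y.
Proof.
have imp h a b : h \in L -> three_cycle_related a b ->
  three_cycle_related (h a) (h b).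
  have [-> | ab] := eqVneq a b; first by rewrite /three_cycle_related !eqxx.
  move=> hL /(three_cycle_relatedP ab)[c Uabc fL].
  apply: (@three_cycle_relatedI _ _ (h c));
    last by rewrite -!tpermJ -conjMg groupJ.
  by move: Uabc; rewrite -(map_inj_uniq (@perm_inj _ h)).
move=> gL x y; apply/idP/idP; last exact: imp.
by move/(imp g^-1 _ _ (groupVr gL)); rewrite !permK.
Qed.

(** All three-cycles then lie in the group, so they lie in its normal core,
    which is not trivial. *)
Lemma three_cycle_related_Alt : 4 < #|T| -> L \subset 'Alt_T ->
  (forall a b, three_cycle_related a b) -> L :=: 'Alt_T.
Proof.
move=> T5 LA Lrel.
have all3 a b c : uniq [:: a; b; c] -> tperm a b * tperm a c \in L.
  move=> Uabc; move: (Uabc); rewrite /= !inE !negb_or andbT.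
  case/andP=> /andP[ab ac] bc.
  have /(three_cycle_relatedP ab)[d Uabd gL] := Lrel a b.
  move: (Uabd); rewrite /= !inE !negb_or andbT => /andP[/andP[_ ad] bd].
  have [<- // | dc] := eqVneq d c.
  have /(three_cycle_relatedP dc)[f Udcf hL] := Lrel d c.
  move: (Udcf); rewrite /= !inE !negb_or andbT => /andP[/andP[_ df] cf].
  have [fa | fa] := eqVneq f a.
    rewrite fa in hL; have U : uniq [:: a; b; c; d] by all_neq.
    by have := groupM gL hL; apply: eq_perm_mem; tword_calc U.
  have [fb | fb] := eqVneq f b.
    rewrite fb in hL; have U : uniq [:: a; b; c; d] by all_neq.
    by have := groupM (groupVr hL) gL; apply: eq_perm_mem; tword_calc U.
  have U : uniq [:: a; b; c; d; f] by all_neq.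
  by have := groupJ gL hL; apply: eq_perm_mem; tword_calc U.
have nL : gcore L 'Alt_T <| 'Alt_T.
  by rewrite /normal gcore_norm (subset_trans (gcore_sub _ _)).
have [L1 | LE] := @Alt_normal_sub _ T5 (gcore_group L 'Alt_T) nL; last first.
  by apply/eqP; rewrite eqEsubset LA -{1}LE gcore_sub.
have [a _] := @exists_notin T [::] (ltnW (ltnW (ltnW (ltnW T5)))).
have [b] := @exists_notin T [:: a] (ltnW (ltnW (ltnW T5))); rewrite inE => ba.
have [c] := @exists_notin T [:: a; b] (ltnW (ltnW T5)).
rewrite !inE negb_or => /andP[ca cb].
have Uabc : uniq [:: a; b; c] by all_neq.
have : tperm a b * tperm a c \in gcore L 'Alt_T.
  apply/bigcapP=> x _; rewrite mem_conjg conjMg !tpermJ; apply: all3.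
  by move: Uabc; rewrite -(map_inj_uniq (@perm_inj _ x^-1)).
rewrite /= in L1; rewrite L1 => /set1gP/permP/(_ a).
by rewrite permM perm1 tpermL; tperm_eval => /eqP; rewrite (negPf ba).
Qed.

End ThreeCycles.

(** * Proper subgroups of the alternating group *)

Lemma equivalence_base3 (T : finType) (L : {group {perm T}}) (e : rel T) a b c
  q :
    4 < #|T| -> equivalence_rel e ->
    (forall g, g \in L -> forall x y, e (g x) (g y) = e x y) ->
    uniq [:: a; b; c] -> e a b -> e a c -> ~~ e a q ->
  exists2 s, size s <= #|T| - 2 & conjugates_meet_trivially 'Alt_T L s.
Proof.
move=> T5 ee eL Uabc ab ac; apply: equivalence_base => //.
have <- : #|[:: a; b; c]| = 3 := card_uniqP Uabc.
apply/subset_leq_card/subsetP => x.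
by rewrite !inE => /or3P[] /eqP-> //; apply: equivalence_refl ee _.
Qed.

Lemma fixed_point_base (T : finType) (L : {group {perm T}}) (r : T) :
    4 < #|T| -> (forall g, g \in L -> g r = r) ->
  exists2 s, size s <= #|T| - 2 & conjugates_meet_trivially 'Alt_T L s.
Proof.
move=> T5 Lr.
have [a] := @exists_notin T [:: r] (ltnW (ltnW (ltnW T5))); rewrite inE => ar.
have [b] := @exists_notin T [:: r; a] (ltnW (ltnW T5)).
rewrite !inE negb_or => /andP[br ba].
have [c] := @exists_notin T [:: r; a; b] (ltnW T5).
rewrite !inE !negb_or => /and3P[cr ca cb].
apply: (@equivalence_base3 T L (fun x y => (x == r) == (y == r)) a b c r) =>
  //=.
- by move=> x y z; split=> // /eqP->.
- move=> g gL x y; have gE z : (g z == r) = (z == r).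
    by rewrite -{1}(Lr g gL) (inj_eq perm_inj).
  by rewrite !gE.
- by all_neq.
- by rewrite (negPf ar) (negPf br).
- by rewrite (negPf ar) (negPf cr).
by rewrite (negPf ar) eqxx.
Qed.

Theorem proper_subgroup_base (T : finType) (L : {group {perm T}}) :
    4 < #|T| -> L \proper 'Alt_T ->
  exists2 s, size s <= #|T| - 2 & conjugates_meet_trivially 'Alt_T L s.
Proof.
move=> T5 prL; have LA := proper_sub prL.
case: (pickP [pred u : T * T * T | let: (a, b, c) := u in
    uniq [:: a; b; c] && (tperm a b * tperm a c \in L)]) => [[[a b] c]|noL].
  case/andP=> Uabc gL; have ab := three_cycle_relatedI Uabc gL.
  have ac : three_cycle_related L a c.
    apply: (@three_cycle_relatedI _ _ _ _ b); last first.
      by have := groupVr gL; apply: eq_perm_mem; tword_calc Uabc.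
    by move: Uabc; rewrite /= !inE !negb_or andbT => /andP[/andP[? ?] ?];
      all_neq.
  have [/forallP aT | ] := boolP [forall q, three_cycle_related L a q].
    have := proper_subn prL; rewrite (three_cycle_related_Alt T5 LA) ?subxx //.
    move=> x y; apply: three_cycle_related_trans (aT y).
    exact: three_cycle_related_sym.
  rewrite negb_forall => /existsP[q aq].
  apply: equivalence_base3 ab ac aq => //.
    exact: three_cycle_related_equiv.
  exact: three_cycle_related_perm.
have L3 : three_cycle_free L.
  by move=> a b c U; apply/negP=> gL; have /= := noL (a, b, c);
    move: U gL => /= -> ->.
have [p _] := @exists_notin T [::] (ltnW (ltnW (ltnW (ltnW T5)))).
have [r] := @exists_notin T [:: p] (ltnW (ltnW (ltnW T5))); rewrite inE => rp.
pose M := (L :^ tperm p r)%G; have ML : M :=: L :^ tperm p r by [].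
have MAlt : M \subset 'Alt_T.
  apply/subsetP=> x; rewrite mem_conjg => /(subsetP LA).
  by rewrite !Alt_even odd_permJ.
have M3 : three_cycle_free M.
  move=> a b c; rewrite -(map_inj_uniq (@perm_inj _ (tperm p r)^-1)).
  by rewrite mem_conjg conjMg !tpermJ; apply: L3.
have pr : p != r by rewrite eq_sym.
pose J := ~: [set p; r].
have [/forall_inP K1 | ] := boolP [forall k in star_group M p J, k == 1].
  exists (star_conjugators p r p J).
    rewrite size_map -cardE -(cardsC [set p; r]) cards2 pr.
    by rewrite addnC addnK.
  split=> [|g gA gs]; last exact/eqP/K1/(star_conjugatorsP ML).
  by apply: star_conjugators_Alt; rewrite // !inE eqxx.
rewrite negb_forall_in => /exists_inP[k kS k1].
have kM := full_star_mem M3 rp T5 MAlt kS.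
have [kk kne kSwap] := full_star_involution M3 rp T5 kM kS k1.
have [krr | krr] := eqVneq (k r) r; last first.
  apply: (involution_base T5 pr ML M3 prL kM kk kSwap) => x.
  by have [-> | /kne] := eqVneq x r.
apply: (@fixed_point_base T L p T5) => g gL.
have := pair_swaps_fixed_point M3 MAlt kM kk kSwap T5 krr kne.
move=> /(_ (g ^ tperm p r)); rewrite memJ_conjg => /(_ gL).
rewrite conjgE tpermV !permM tpermR => E.
by apply: (@perm_inj _ (tperm p r)); rewrite E tpermL.
Qed.

(** * Closures and bases *)

Section Closure.

Import boolp classical_sets.

Section Action.

Variables (gT : finGroupType) (G : {group gT}) (Omega : Type).
Variable to : action G Omega.

Lemma actionM x a b : a \in G -> b \in G -> to x (a * b) = to (to x a) b.
Proof. by case: to => f [_ fM] /=; apply: fM. Qed.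

Lemma action1 x : to x 1 = x.
Proof.
have to_inj : injective (to^~ 1).
  by case: to => f [f_inj fM] y z; apply: f_inj.
by apply: to_inj; rewrite -actionM ?group1 // mulg1.
Qed.

Lemma actionK a : a \in G -> cancel (to^~ a) (to^~ a^-1).
Proof. by move=> aG x; rewrite -actionM ?groupV // mulgV action1. Qed.

Lemma actionKV a : a \in G -> cancel (to^~ a^-1) (to^~ a).
Proof. by move=> aG x; rewrite -actionM ?groupV // mulVg action1. Qed.

Lemma map_tupleM k (t : k.-tuple Omega) a b : a \in G -> b \in G ->
  map_tuple (to^~ (a * b)) t = map_tuple (to^~ b) (map_tuple (to^~ a) t).
Proof.
move=> aG bG; apply/val_inj; rewrite /= -map_comp.
by apply: eq_map => x /=; rewrite actionM.
Qed.

Lemma induced_sub_k_closure k :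
  (induced_permutations to `<=` k_closure k to)%classic.
Proof.
move=> _ [a aG <-]; split=> [|t].
  by exists (to^~ a^-1); [apply: actionK | apply: actionKV].
apply/seteqP; split=> [_ [_ [b bG <-] <-] | _ [b bG <-]].
  by exists (b * a); rewrite /= ?groupM // map_tupleM.
exists (map_tuple (to^~ (b * a^-1)) t); first by exists (b * a^-1) => //=;
  rewrite groupM ?groupV.
by rewrite -map_tupleM ?groupM ?groupV // mulgKV.
Qed.

(** Testing the permutation on the base together with one more point [y] yields
    a group element that agrees with it at [y]; it does not depend on [y],
    because it is determined by its values on the base. *)
Lemma k_closure_of_base k (b : seq Omega) :
    size b <= k ->
    (forall a, a \in G -> [seq to x a | x <- b] = b -> a = 1) ->
  k_closure k.+1 to = induced_permutations to.
Proof.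
move=> sb baseb; apply/seteqP; split; last exact: induced_sub_k_closure.
move=> g [_ gorb].
have agree y :
    exists2 a, a \in G & g y = to y a /\ map g b = [seq to x a | x <- b].
  (* The tuple is padded to the required length with copies of [y]. *)
  have tP : size (y :: b ++ nseq (k - size b) y) == k.+1.
    by rewrite /= size_cat size_nseq subnKC.
  pose t := Tuple tP.
  have tt : tuple_orbit to t t.
    exists 1; [exact: group1 | apply/val_inj].
    by rewrite -[RHS]map_id; apply: eq_map => x; apply: action1.
  have : (map_tuple g @` tuple_orbit to t)%classic (map_tuple g t) by exists t.
  rewrite gorb => -[a aG /(congr1 val) /= [gy /(congr1 (take (size b)))]].
  rewrite !map_cat !take_size_cat ?size_map // => gb.
  by exists a.
have [[y0 _] | noy] := pselect (exists y : Omega, True); last first.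
  exists 1; first exact: group1.
  by apply: funext => y; case: noy; exists y.
have [a aG [_ gb]] := agree y0; exists a => //; apply: funext => y.
have [c cG [-> gc]] := agree y; congr (to y _); apply/(mulIg c^-1).
rewrite mulgV; apply: baseb; first by rewrite groupM ?groupV.
have -> : [seq to x (a * c^-1) | x <- b] =
    [seq to x c^-1 | x <- [seq to x a | x <- b]].
  by rewrite -map_comp; apply: eq_map => x /=; rewrite actionM ?groupV.
rewrite -gb gc -map_comp -[RHS]map_id; apply: eq_map => x.
exact: actionK.
Qed.

Definition point_stabiliser (x : Omega) : {set gT} :=
  [set a in G | `[< to x a = x >]]%SET.

Lemma point_stabiliserP x a :
  reflect (a \in G /\ to x a = x) (a \in point_stabiliser x).
Proof.
rewrite inE; apply: (iffP andP) => -[aG]; first by move/asboolP.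
by move=> xa; split=> //; apply/asboolP.
Qed.

Lemma group_set_point_stabiliser x : group_set (point_stabiliser x).
Proof.
apply/group_setP; split=> [|a b].
  by apply/point_stabiliserP; rewrite group1 action1.
move=> /point_stabiliserP[aG xa] /point_stabiliserP[bG xb].
by apply/point_stabiliserP; rewrite groupM // actionM // xa.
Qed.

Canonical point_stabiliser_group x := Group (group_set_point_stabiliser x).

Lemma mem_point_stabiliserJ x a c :
  a \in G -> c \in G -> to (to x c) a = to x c -> a \in point_stabiliser x :^ c.
Proof.
move=> aG cG xca; rewrite mem_conjg conjgE invgK; apply/point_stabiliserP.
rewrite !groupM ?groupV //; split=> //.
by rewrite !actionM ?groupM ?groupV // xca actionK.
Qed.

End Action.

Lemma Alt_totally_closed (n : nat) : 4 < n ->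
  totally_closed (n - 1) 'Alt_('I_n).
Proof.
move=> n5 Omega to faith; have T5 : 4 < #|'I_n| by rewrite card_ord.
have [x [a aA xa]] : exists x, exists2 a, a \in 'Alt_('I_n) & to x a <> x.
  apply/not_existsP => fixA;
    have /simpleP[/trivgPn[a aA a1] _] := simple_Alt5 T5.
  case/eqP: a1; apply: faith => // x; apply: contrapT => xa.
  by apply: (fixA x); exists a.
have prL : point_stabiliser to x \proper 'Alt_('I_n).
  apply/properP; split; first by apply/fintype.subsetP=> c /point_stabiliserP[].
  by exists a => //; apply/point_stabiliserP=> -[].
have [s les [sA sK]] := proper_subgroup_base T5 prL.
have -> : n - 1 = (n - 2).+1 by rewrite -subSn ?(leq_trans _ n5).
apply: (@k_closure_of_base _ _ _ to _ [seq to x c | c <- s]).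
  by rewrite size_map -[n in n - 2]card_ord.
move=> c cA cs; apply: sK => // d ds.
apply: mem_point_stabiliserJ => //; first exact: sA.
by move: cs; rewrite -map_comp => /eq_in_map; apply.
Qed.

Definition Alt_natural (n : nat) : action 'Alt_('I_n) 'I_n :=
  ('P \ finset.subsetT _)%act.

(** In the natural action the closure contains the transposition of two
    points. *)
Lemma Alt_not_totally_closed (n j : nat) :
  4 < n -> totally_closed j 'Alt_('I_n) -> n - 1 <= j.
Proof.
move=> n5 closed; rewrite leqNgt; apply/negP => ltj.
pose to := Alt_natural n.
have faith : faithful_action to.
  by move=> a _ fa; apply/permP=> x; rewrite perm1; apply: fa.
have n2 : 1 < n by apply: leq_trans n5.
pose u : 'I_n := Ordinal (ltnW n2); pose v : 'I_n := Ordinal n2.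
have uv : u != v by [].
have odd_shift (t : j.-tuple 'I_n) (h : {perm 'I_n}) : odd_perm h ->
    exists2 c, c \in 'Alt_('I_n) & map_tuple (to^~ c) t = map_tuple h t.
  move=> oddh; have [|x] := @exists_notin 'I_n t.
    by rewrite size_tuple card_ord (leq_trans ltj) ?leq_subr.
  move=> xt; have [|y] := @exists_notin 'I_n (x :: t).
    by rewrite /= size_tuple card_ord; move: ltj; rewrite ltn_subRL add1n.
  rewrite inE negb_or => /andP[yx yt].
  exists (tperm x y * h).
    by rewrite Alt_even odd_permM odd_tperm eq_sym yx oddh.
  apply/val_inj/eq_in_map => z zt; rewrite /= /aperm permM tpermD //.
    by apply: contraNneq xt => ->.
  by apply: contraNneq yt => ->.
have : k_closure j to (tperm u v).
  split=> [|t]; first by exists (tperm u v) => x; rewrite tpermK.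
  apply/seteqP; split=> [_ [_ [c cA <-] <-] | _ [c cA <-]].
    have [|d dA dE] := @odd_shift t (c * tperm u v).
      by rewrite odd_permM odd_tperm uv; move: cA;
        rewrite /= Alt_even => /negPf->.
    exists d => //; rewrite dE; apply/val_inj; rewrite /= -map_comp.
    by apply: eq_map => x /=; rewrite permM.
  have [|d dA dE] := @odd_shift t (c * tperm u v).
    by rewrite odd_permM odd_tperm uv; move: cA;
      rewrite /= Alt_even => /negPf->.
  exists (map_tuple (to^~ d) t); first by exists d.
  rewrite dE; apply/val_inj; rewrite /= -map_comp.
  by apply: eq_map => x /=; rewrite permM tpermK.
rewrite (closed _ to faith) => -[c cA cE].
have : c = tperm u v by apply/permP=> x; rewrite -cE.
by move=> cE'; move: cA; rewrite /= cE' Alt_even odd_tperm uv.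
Qed.

End Closure.

Theorem theorem1p1 (n : nat) (hn : 5 <= n) :
  closure_number ('Alt_('I_n))%G = n - 1.
Proof.
apply: classical_sets.xget_unique => [|k [k0 kclosed kmin]].
  split; first by rewrite subn_gt0 (leq_trans _ hn).
    exact: Alt_totally_closed.
  by move=> j _; apply: Alt_not_totally_closed.
apply/eqP; rewrite eqn_leq (Alt_not_totally_closed hn kclosed) andbT.
apply: kmin; first by rewrite subn_gt0 (leq_trans _ hn).
exact: Alt_totally_closed.
Qed.
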